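(* Let $\Gamma$ be a discrete abelian group with dual group $G$, let $K$ be a subset of $\Gamma$, and let $\mu$ be a regular Borel measure on $G$. If there is an enumeration $(\gamma_j)$ of $K$ such that $\hat\mu$ vanishes on the set $S((\gamma_j))$, then $$\left[\sum_{\gamma\in K}|\hat\mu(\gamma)|^2\right]^{1/2} \le 4\|\mu\|.$$
   Context: Measures are (finite) complex regular Borel measures on the compact abelian group $G$; $\|\mu\|$ denotes the total variation of $\mu$, and $\hat\mu(\gamma)=\int_G\overline{\gamma(x)}\,d\mu(x)$ for $\gamma\in\Gamma$, where elements of $\Gamma$ are regarded as characters of $G$. The group $\Gamma$ is written additively. An enumeration $(\gamma_j)$ of $K$ lists the elements of $K$, each once, as a sequence indexed by an interval of integers (finite, one-sided infinite in either direction, or all of $\mathbb{Z}$); no order or lacunarity condition is imposed. Given such a sequence $(\gamma_j)$, $S((\gamma_j))$ is the set of all elements $\gamma\in\Gamma$ having at least one representation $\gamma=\sum_{j'}\varepsilon_{j'}\gamma_{j'}$ (sum over the index interval) in which every coefficient $\varepsilon_{j'}$ belongs to $\{-1,0,1\}$, only finitely many are nonzero, and, with the partial sums of the coefficients taken in index order, i.e. $\sigma_j=\sum_{j'\le j}\varepsilon_{j'}$: (1) the full sum $\sum_{j'}\varepsilon_{j'}$ equals $1$; (2) all partial sums $\sigma_j$ are nonnegative; (3) all partial sums after the first positive one are positive; (4) some partial sum is greater than $1$. *)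

(* Defs.v *)
From HB Require Import structures.
From mathcomp Require Import all_boot all_order all_algebra.
From mathcomp Require Import complex.
From mathcomp Require Import all_classical all_reals all_analysis.

Set Implicit Arguments.
Unset Strict Implicit.
Unset Printing Implicit Defensive.

Import Order.TTheory GRing.Theory Num.Theory.
Import numFieldNormedType.Exports.
Import ComplexField.Normc.

Local Open Scope classical_set_scope.
Local Open Scope ring_scope.
Local Open Scope complex_scope.

(** * Complex measures *)

(* [R[i]^o] carries the norm topology of the field [R[i]]; the values of the
   underlying function on non-measurable sets are irrelevant. *)
Record complex_measure d (T : measurableType d) (R : realType) :=
  ComplexMeasure {
    cmeasure_fun :> set T -> R[i] ;
    cmeasure_sigma_additive : forall F : (set T)^nat,
      (forall n, measurable (F n)) -> trivIset setT F ->
      (fun n => \sum_(0 <= k < n) cmeasure_fun (F k) : R[i]^o) @ \oo -->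
      (cmeasure_fun (\bigcup_n F n) : R[i]^o) }.

Section charge_of_part.
Context d (T : measurableType d) (R : realType).
Variables (p : R[i] -> R) (mu : complex_measure T R).
Hypothesis pB : {morph p : x y / x - y}.
Hypothesis pD : {morph p : x y / x + y}.
Hypothesis p_le : forall z, `|p z| <= normc z.

Lemma charge_part_cvg (u : nat -> R[i]) (l : R[i]) :
  (u : nat -> R[i]^o) @ \oo --> (l : R[i]^o) -> p (u n) @[n --> \oo] --> p l.
Proof.
move=> ul; apply/cvgrPdist_lt => e e0.
have e0' : 0 < e%:C by rewrite ltcR.
have /cvgrPdist_lt/(_ _ e0') := ul.
apply: filterS => n /=.
rewrite -pB -(ltcR `|_|) => h; apply: le_lt_trans h.
by rewrite lecR; exact: p_le.
Qed.

Definition charge_part (A : set T) : \bar R := (p (mu A))%:E.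

Let p0 : p 0 = 0. Proof. by rewrite -(subr0 0) pB subrr. Qed.

Let charge_part_series (F : (set T)^nat) : (forall n, measurable (F n)) ->
  trivIset setT F ->
  (fun n => \sum_(0 <= k < n) p (mu (F k))) @ \oo --> p (mu (\bigcup_n F n)).
Proof.
move=> mF tF.
rewrite (_ : (fun _ => _) = (fun n => p (\sum_(0 <= k < n) mu (F k)))).
  exact: charge_part_cvg (cmeasure_sigma_additive mF tF).
by apply/funext => n; rewrite (big_morph p pD p0).
Qed.

Lemma charge_part0 : charge_part set0 = 0%E.
Proof.
have m0 (n : nat) : measurable (@set0 T) by [].
have t0 : trivIset setT (fun _ : nat => @set0 T).
  by apply/trivIsetP => i j _ _ _; rewrite setI0.
have /cvgP/cvg_series_cvg_0 h := charge_part_series m0 t0.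
by rewrite /charge_part; congr EFin; exact: cvg_unique (cvg_cst _) h.
Qed.

Lemma charge_part_fin A : measurable A -> charge_part A \is a fin_num.
Proof. by []. Qed.

Lemma charge_part_sigma_additive : semi_sigma_additive charge_part.
Proof.
move=> F mF tF _; rewrite /charge_part.
rewrite (_ : (fun _ => _) = EFin \o (fun n => \sum_(0 <= k < n) p (mu (F k)))).
  by apply: cvg_EFin; [exact: nearW|exact: charge_part_series].
by apply/funext => n; rewrite /= sumEFin.
Qed.

End charge_of_part.

Section real_and_imaginary_parts.
Context d (T : measurableType d) (R : realType).
Variable mu : complex_measure T R.

Lemma normr_Re_le (z : R[i]) : `|complex.Re z| <= normc z.
Proof. by rewrite -lecR; exact: normc_ge_Re. Qed.

Lemma normr_Im_le (z : R[i]) : `|complex.Im z| <= normc z.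
Proof. by case: z => a b /=; rewrite -sqrtr_sqr ler_wsqrtr// lerDr sqr_ge0. Qed.

Let ReB : {morph @complex.Re R : x y / x - y}. Proof. by case=> ? ? []. Qed.
Let ReD : {morph @complex.Re R : x y / x + y}. Proof. by case=> ? ? []. Qed.
Let ImB : {morph @complex.Im R : x y / x - y}. Proof. by case=> ? ? []. Qed.
Let ImD : {morph @complex.Im R : x y / x + y}. Proof. by case=> ? ? []. Qed.

Definition cmeasure_Re : set T -> \bar R := charge_part (@complex.Re R) mu.

HB.instance Definition _ := isCharge.Build _ _ _ cmeasure_Re
  (charge_part0 mu ReB ReD normr_Re_le) (@charge_part_fin _ _ _ _ mu)
  (charge_part_sigma_additive (mu := mu) ReB ReD normr_Re_le).

Definition cmeasure_Im : set T -> \bar R := charge_part (@complex.Im R) mu.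

HB.instance Definition _ := isCharge.Build _ _ _ cmeasure_Im
  (charge_part0 mu ImB ImD normr_Im_le) (@charge_part_fin _ _ _ _ mu)
  (charge_part_sigma_additive (mu := mu) ImB ImD normr_Im_le).

End real_and_imaginary_parts.

(* The positive and negative parts do not depend on the chosen Hahn
   decomposition (lemma [Hahn_decomposition_uniq]). *)
Definition charge_integral d (T : measurableType d) (R : realType)
    (nu : {charge set T -> \bar R}) (f : T -> R) : R :=
  let nuPN := projT2 (cid (projT2 (cid (Hahn_decomposition nu)))) in
  \int[jordan_pos nuPN]_x f x - \int[jordan_neg nuPN]_x f x.

(* Meant for integrands with bounded measurable real and imaginary parts. *)
Definition cmeasure_integral d (T : measurableType d) (R : realType)
    (mu : complex_measure T R) (f : T -> R[i]) : R[i] :=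
  let u x := complex.Re (f x) in
  let v x := complex.Im (f x) in
  (charge_integral (cmeasure_Re mu) u - charge_integral (cmeasure_Im mu) v)
  +i* (charge_integral (cmeasure_Re mu) v + charge_integral (cmeasure_Im mu) u).

(* [cmeasure_variation mu E] is $|\mu|(E)$: the supremum of
   $\sum_i |\mu(E_i)|$ over the finite measurable partitions of $E$. *)
Definition cmeasure_variation d (T : measurableType d) (R : realType)
    (mu : complex_measure T R) (E : set T) : \bar R :=
  ereal_sup [set s | exists (n : nat) (F : 'I_n -> set T),
    [/\ forall i, measurable (F i), trivIset setT F, \bigcup_i F i = E &
        s = (\sum_(i < n) (normc (mu (F i)))%:E)%E]].

Definition cmeasure_norm d (T : measurableType d) (R : realType)
    (mu : complex_measure T R) : \bar R := cmeasure_variation mu setT.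

(** * The dual group *)

(* An abelian group [Gamma : zmodType] has no topology, that is, it is discrete:
   all its homomorphisms to the circle are continuous. The dual group has the
   topology of pointwise convergence, which for discrete [Gamma] is the
   compact-open topology. *)
Definition characters (R : realType) (Gamma : zmodType) :
    set {ptws Gamma -> R[i]^o} :=
  [set f | (forall a b, f (a + b) = f a * f b) /\ forall a, normc (f a) = 1].
Arguments characters : clear implicits.

Definition dual (R : realType) (Gamma : zmodType) : Type :=
  set_type (characters R Gamma).

Section dual_structures.
Variables (R : realType) (Gamma : zmodType).

Lemma trivial_character : (fun=> 1) \in characters R Gamma.
Proof. by rewrite inE; split=> *; rewrite ?mulr1 ?normc1. Qed.

HB.instance Definition _ :=
  Topological.copy (dual R Gamma) (set_type (characters R Gamma)).
HB.instance Definition _ :=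
  isPointed.Build (dual R Gamma) (SigSub trivial_character).
HB.instance Definition _ := Measurable.copy (dual R Gamma)
  (g_sigma_algebraType (@open (dual R Gamma))).

End dual_structures.

Definition pairing (R : realType) (Gamma : zmodType) (c : Gamma)
  (x : dual R Gamma) : R[i] := set_val x c.

Definition regular_measure (R : realType) (Gamma : zmodType)
    (mu : complex_measure (dual R Gamma) R) : Prop :=
  forall E : set (dual R Gamma), measurable E ->
    cmeasure_variation mu E =
      ereal_sup [set cmeasure_variation mu C
                  | C in [set C | compact C /\ C `<=` E]] /\
    cmeasure_variation mu E =
      ereal_inf [set cmeasure_variation mu U
                  | U in [set U | open U /\ E `<=` U]].

Definition fourier_transform (R : realType) (Gamma : zmodType)
    (mu : complex_measure (dual R Gamma) R) (c : Gamma) : R[i] :=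
  cmeasure_integral mu (fun x => (pairing c x)^*).

(** * Enumerations and the set S *)

(* [interval int] contains the finite, half-infinite and full intervals. *)
Definition enumeration (Gamma : zmodType) (K : set Gamma) (J : interval int)
  (g : int -> Gamma) : Prop := set_bij [set` J] K g.

Definition partial_sum (J : interval int) (eps : int -> int) (j : int) : int :=
  \sum_(k \in [set k | k \in J /\ k <= j]) eps k.

(* The values of [eps] and [g] outside [J] are irrelevant. *)
Definition admissible (J : interval int) (eps : int -> int) : Prop :=
  [/\ forall j, j \in J -> eps j \in [:: -1; 0; 1],
      finite_set [set j | j \in J /\ eps j != 0] &
  [/\ \sum_(j \in [set` J]) eps j = 1,
      forall j, j \in J -> 0 <= partial_sum J eps j,
      forall i j, i \in J -> j \in J -> i <= j ->
        0 < partial_sum J eps i -> 0 < partial_sum J eps j &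
      exists2 j, j \in J & 1 < partial_sum J eps j]].

Definition S_set (Gamma : zmodType) (J : interval int) (g : int -> Gamma) :
    set Gamma :=
  [set c | exists2 eps : int -> int, admissible J eps &
    c = \sum_(j \in [set` J]) g j *~ eps j].

(* Main.v *)
Require Import Defs.
From mathcomp Require Import all_boot all_order all_algebra.
From mathcomp Require Import cyclic separable cyclotomic.
From mathcomp Require Import complex.
From mathcomp Require Import all_classical all_reals all_analysis.
From mathcomp Require Import measurable_realfun.
From mathcomp Require Import ring lra zify.

(* Fix finitely many frequencies g_0, ..., g_m of the enumeration. Averaging the
   Riesz products prod_l (1 + Re (z_l * conj g_l)) against mu produces a
   trigonometric polynomial f in the variables z_l, with L^1 norm at most
   ||mu||, spectrum in {-1, 0, 1}^(m+1) and coefficients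
   2^-|e| * hat mu (sum_l e_l g_l); the factor 1/2 lost at the frequencies g_l
   accounts for one half of the constant 4. The variables z_l run over the N-th
   roots of unity, N large, so that all integrals over the torus are finite sums.

   The other factor 2 comes from Hilbert space geometry in L^2(|f|), where
   f = phi |f|. Let V_j be spanned by the monomials of exponents with total 1
   and nonnegative partial sums, positive from the first positive one on, which
   start before j, or start at j and reach a partial sum > 1. Then V_j
   increases with j, contains z_i for i < j, and the multiples by z_j / z_{j+1}
   of elements of V_{j+1} belong to V_j and are orthogonal to phi. Hence, v_j
   being the projection of z_j on V_j, both (<phi, z_j - v_j>)_j and
   (<phi, v_j>)_j have l^2 norm at most ||f||_1: the z_j - v_j are orthogonal,
   and <phi, v_j> is controlled by the increments of the projections of 1 on the
   decreasing spaces conj(z_j) V_j. In order to remain below N, the exponents in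
   V_j are truncated, which costs an arbitrarily small error. *)

Set Implicit Arguments.
Unset Strict Implicit.
Unset Printing Implicit Defensive.

Import Order.TTheory GRing.Theory Num.Theory.
Import numFieldNormedType.Exports.
Import ComplexField.Normc.

Local Open Scope classical_set_scope.
Local Open Scope complex_scope.
Local Open Scope ring_scope.

(** * Two elementary inequalities *)

(** The gap is at least [(|x| - k |y|)^2]. After division by [k], the factor of [|x|^2] is
    [1 + 1/k], so that a small [y] costs almost nothing. *)
Lemma sqr_norm_weighted (C : numClosedFieldType) (k : nat) (x y : C) : (0 < k)%N ->
  k%:R * `|x + y| ^+ 2 <= k.+1%:R * `|x| ^+ 2 + (k * k.+1)%:R * `|y| ^+ 2.
Proof.
move=> k0; apply: (@le_trans _ _ (k%:R * (`|x| + `|y|) ^+ 2)).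
  by rewrite ler_wpM2l// lerXn2r ?nnegrE ?addr_ge0// ler_normD.
rewrite -subr_ge0.
have -> : k.+1%:R * `|x| ^+ 2 + (k * k.+1)%:R * `|y| ^+ 2 - k%:R * (`|x| + `|y|) ^+ 2
   = (`|x| - k%:R * `|y|) ^+ 2 by rewrite natrM -natr1; ring.
by rewrite real_exprn_even_ge0// realB ?realM ?normr_real ?realn.
Qed.

(** The [L] decrements telescope to at most [F 0 <= K], so they cannot all exceed [K / L]. *)
Lemma small_decrement (C : numClosedFieldType) (F : nat -> C) (K : C) (L : nat) : (0 < L)%N ->
  (forall l, 0 <= F l) -> F 0%N <= K ->
  exists2 l, (l < L)%N & L%:R * (F l - F l.+1) <= K.
Proof.
move=> L0 F0 FK; apply: contrapT => nex.
have FR l : F l \is Num.real by exact: ger0_real.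
have KR : K \is Num.real by apply: ger0_real; exact: le_trans FK.
have lt l : (l < L)%N -> K < L%:R * (F l - F l.+1).
  move=> lL; rewrite real_ltNge ?realM ?realB ?realn//.
  by apply/negP => h; apply: nex; exists l.
have : \sum_(l < L) K < \sum_(l < L) L%:R * (F l - F l.+1).
  apply: ltr_sum; last by move=> i _; exact: lt.
  by apply/hasP; exists (Ordinal L0); rewrite ?mem_index_enum.
rewrite -mulr_sumr sumr_const card_ord -[ltLHS]mulr_natl ltr_pM2l ?ltr0n//.
rewrite -(big_mkord xpredT (fun l => F l - F l.+1)).
under eq_bigr do rewrite -opprB.
rewrite sumrN telescope_sumr// opprB => h.
have : K < K by rewrite (lt_le_trans h)// (le_trans _ FK)// gerBl.
by rewrite ltxx.
Qed.

(** * Positive semidefinite Hermitian forms *)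

Section SemiInnerProduct.
Variables (C : numClosedFieldType) (E : vectType C) (Q : E -> E -> C).
Hypothesis QP : forall p a q r, Q p (a *: q + r) = a * Q p q + Q p r.
Hypothesis QC : forall p q, Q q p = (Q p q)^*.
Hypothesis Qge0 : forall p, 0 <= Q p p.

Lemma sip0r p : Q p 0 = 0.
Proof.
have := QP p 1 0 0; rewrite scale1r addr0 mul1r => /eqP.
by rewrite -subr_eq subrr => /eqP<-.
Qed.

Lemma sipDr p q r : Q p (q + r) = Q p q + Q p r.
Proof. by have := QP p 1 q r; rewrite scale1r mul1r. Qed.

Lemma sipZr p a q : Q p (a *: q) = a * Q p q.
Proof. by have := QP p a q 0; rewrite !addr0 sip0r addr0. Qed.

Lemma sipBr p q r : Q p (q - r) = Q p q - Q p r.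
Proof. by rewrite addrC -scaleN1r QP mulN1r addrC. Qed.

Lemma sipDl p q r : Q (p + q) r = Q p r + Q q r.
Proof. by rewrite QC sipDr rmorphD /= -!QC. Qed.

Lemma sipZl a p q : Q (a *: p) q = a^* * Q p q.
Proof. by rewrite QC sipZr rmorphM /= -QC. Qed.

Lemma sipBl p q r : Q (p - q) r = Q p r - Q q r.
Proof. by rewrite QC sipBr rmorphB /= -!QC. Qed.

Lemma sip_sumr (I : finType) p (F : I -> E) :
  Q p (\sum_i F i) = \sum_i Q p (F i).
Proof. exact: (big_morph (Q p) (sipDr p) (sip0r p)). Qed.

Lemma sip_suml (I : finType) p (F : I -> E) :
  Q (\sum_i F i) p = \sum_i Q (F i) p.
Proof. by rewrite QC sip_sumr rmorph_sum /=; apply: eq_bigr => i _; rewrite -QC. Qed.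

Lemma sip_pythagoras u v : Q u v = 0 -> Q (u + v) (u + v) = Q u u + Q v v.
Proof. by move=> uv; rewrite sipDr !sipDl uv (QC u v) uv conjC0; ring. Qed.

(** [QE] is used with [t = 1 / Q q q]. As [Q] may be degenerate, [Q q q = 0] is possible; unless
    [Q p q = 0], a large [t] then makes the form equal to [- (Q p p + 2) < 0]. *)
Lemma sip_CauchySchwarz p q : `|Q p q| ^+ 2 <= Q p p * Q q q.
Proof.
have QE t : Q (p - (t * Q q p) *: q) (p - (t * Q q p) *: q) =
    Q p p - (t + t^* - t * t^* * Q q q) * `|Q p q| ^+ 2.
  rewrite sipBr !sipBl !sipZr !sipZl rmorphM /= -(QC q p) normCK -(QC p q); ring.
have [q0|q0] := eqVneq (Q q q) 0; last first.
  have := Qge0 (p - ((Q q q)^-1 * Q q p) *: q).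
  rewrite QE geC0_conj ?invr_ge0// divfK// addrK subr_ge0.
  by rewrite ler_pdivrMl ?lt0r ?q0 ?Qge0// mulrC.
rewrite q0 mulr0; have [->|n0] := eqVneq (`|Q p q| ^+ 2) 0 => //.
have n_gt0 : 0 < `|Q p q| ^+ 2 by rewrite lt0r n0 exprn_ge0.
have t0 : 0 <= (Q p p + 1) / `|Q p q| ^+ 2.
  by rewrite divr_ge0 ?(ltW n_gt0)// addr_ge0.
have := Qge0 (p - ((Q p p + 1) / `|Q p q| ^+ 2 * Q q p) *: q).
rewrite QE geC0_conj// q0 mulr0 subr0 mulrDl divfK//.
have -> : Q p p - (Q p p + 1 + (Q p p + 1)) = - (Q p p + 2) by ring.
have p2 : 0 < Q p p + 2 by rewrite ltr_wpDl.
by rewrite oppr_ge0 => /(lt_le_trans p2); rewrite ltxx.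
Qed.

(** The [e i] are not normalized and may be null vectors, hence the bound [B]. Cauchy-Schwarz for
    [p] and [q] gives [A ^+ 2 <= Q p p * (B * A)]. *)
Lemma sip_bessel (I : finType) (e : I -> E) (B : C) p :
  (forall i j, i != j -> Q (e i) (e j) = 0) ->
  (forall i, Q (e i) (e i) <= B) -> 0 <= B ->
  \sum_i `|Q p (e i)| ^+ 2 <= Q p p * B.
Proof.
move=> eo eB B0; set A := \sum_i _.
have A0 : 0 <= A by apply: sumr_ge0 => i _; rewrite exprn_ge0.
pose q := \sum_i (Q (e i) p) *: e i.
have pq : Q p q = A.
  rewrite sip_sumr; apply: eq_bigr => i _.
  by rewrite sipZr (QC p) mulrC -normCK.
have qq : Q q q <= B * A.
  rewrite sip_sumr mulr_sumr ler_sum// => i _.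
  rewrite sipZr sip_suml (bigD1 i)//= big1 ?addr0; last first.
    by move=> j ji; rewrite sipZl eo ?mulr0.
  rewrite sipZl mulrA [in X in X * _](QC p) conjCK -normCKC.
  by rewrite mulrC ler_wpM2r ?exprn_ge0.
have [A00|An0] := eqVneq A 0.
  by rewrite A00 mulr_ge0.
have A_gt0 : 0 < A by rewrite lt0r An0.
have := sip_CauchySchwarz p q; rewrite pq ger0_norm// => h.
rewrite -(ler_pM2r A_gt0) -expr2 (le_trans h)// -mulrA.
by rewrite ler_wpM2l.
Qed.

(** Gram-Schmidt along a spanning list: [e], the part of [t] orthogonal to the span of [s], supplies
    the component missing from the projection on that span. *)
Lemma sip_projection (U : {vspace E}) u :
  exists2 v, v \in U & forall t, t \in U -> Q (u - v) t = 0.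
Proof.
rewrite -(span_basis (vbasisP U)); elim: (tval _) u => [|t s IHs] u.
  exists 0; first exact: mem0v.
  by move=> t; rewrite span_nil memv0 => /eqP ->; exact: sip0r.
have [t' t's ot] := IHs t; have [v vs ov] := IHs u.
pose e := t - t'; pose c := Q e u / Q e e.
have eE : e \in span (t :: s).
  rewrite span_cons memvB ?(subvP (addvSl _ _) _ (memv_line _))//.
  by rewrite (subvP (addvSr _ _) _ t's).
(* If [Q e e = 0], then [c] is 0 by the convention on division, and Cauchy-Schwarz forces
   [Q e u = 0]. *)
have ce : c * Q e e = Q e u.
  rewrite /c; have [e0|/divfK->//] := eqVneq (Q e e) 0.
  have := sip_CauchySchwarz e u; rewrite e0 mul0r mulr0 => h.
  by apply/esym/eqP; rewrite -normr_eq0 -sqrf_eq0 eq_le h exprn_ge0.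
exists (v + c *: e).
  by rewrite memvD ?memvZ// span_cons (subvP (addvSr _ _)).
move=> r; rewrite span_cons => /memv_addP[_ /vlineP[a ->] [b bs ->]].
have -> : a *: t + b = a *: e + (a *: t' + b) by rewrite /e scalerBr addrA subrK.
have d0 : Q (u - (v + c *: e)) (a *: t' + b) = 0.
  have abs : a *: t' + b \in span s by rewrite memvD ?memvZ.
  by rewrite opprD addrA sipBl ov// sipZl ot// mulr0 subrr.
rewrite sipDr d0 addr0 sipZr opprD addrA sipBl sipZl sipBl (QC e v).
have -> : Q e v = 0 by exact: ot.
rewrite conjC0 subr0.
have := congr1 Num.conj ce; rewrite rmorphM /= -(QC e e) -(QC e u) => ->.
by rewrite subrr mulr0.
Qed.

(** * Projections on a chain of subspaces *)

Section Chains.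
Variables (phi xi : E) (B : C) (m : nat) (g : nat -> E) (T : nat -> E -> E).
Variables (V : nat -> nat -> {vspace E}) (k : nat).
Hypotheses (phiB : Q phi phi <= B) (xiB : Q xi xi <= B) (k0 : (0 < k)%N).
Hypothesis TB : forall j u v, T j (u - v) = T j u - T j v.
Hypothesis TQ : forall j u v, Q (T j u) (T j v) = Q u v.
Hypothesis Tg : forall j, (j <= m)%N -> T j (g j) = xi.
Hypothesis V_homo : forall i j M M', (i <= j <= m)%N -> (M <= M')%N ->
  (V i M <= V j M')%VS.
Hypothesis gV : forall i j M, (i < j <= m)%N -> g i \in V j M.
Hypothesis shiftV : forall j M v, (j < m)%N ->
  (M < m * (k * k.+1 * m.+1))%N -> v \in V j.+1 M ->
  exists v', [/\ v' \in V j M.+1, Q phi v' = 0 & T j v' = T j.+1 v].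

(* [v], the projection of [g j] on [V j M], splits [g j] as [(g j - v) + v].
   The parts [g j - v] are pairwise orthogonal because [V j M] grows with [j].
   The image [T j v] is the projection of [xi] on [T j (V j M)], a space that
   shrinks as [j] grows; by [shiftV], [phi] is orthogonal to the next such
   projection, so that [Q phi v] only sees the difference of two consecutive
   projections of [xi]. Each shift costs one unit of [M]: the second argument
   uses the levels [M0 + (m - j)], the first one the fixed level [M0], and a
   suitable [M0] makes the two projections close to each other. *)
Lemma chain_bound :
  k%:R * \sum_(j < m.+1) `|Q phi (g j)| ^+ 2 <= (4 * k + 5)%:R * B ^+ 2.
Proof.
have B0 : 0 <= B by exact: le_trans phiB.
have /choice[P Pp] (x : {vspace E} * E) : exists v, v \in x.1 /\
    forall t, t \in x.1 -> Q (x.2 - v) t = 0.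
  by have [v vU ov] := sip_projection x.1 x.2; exists v.
pose v j M := P (V j M, g j); pose D j M := Q (g j - v j M) (g j - v j M).
have vV j M : v j M \in V j M by have [] := Pp (V j M, g j).
have vo j M t : t \in V j M -> Q (g j - v j M) t = 0.
  by have [_] := Pp (V j M, g j); apply.
have D0 j M : 0 <= D j M by exact: Qge0.
have Dpyth j M u : u \in V j M ->
    Q (g j - u) (g j - u) = D j M + Q (v j M - u) (v j M - u).
  move=> uV; rewrite -sip_pythagoras ?vo ?memvB//.
  by rewrite addrA subrK.
have gg j : (j <= m)%N -> Q (g j) (g j) = Q xi xi by move=> jm; rewrite -(Tg jm) TQ.
have DB j M : (j <= m)%N -> D j M <= B.
  move=> jm; apply: le_trans xiB; rewrite -(gg _ jm).
  by have := Dpyth j M 0 (mem0v _); rewrite !subr0 => ->; rewrite lerDl.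
have Ddiff j M M' : (j <= m)%N -> (M <= M')%N ->
    Q (v j M - v j M') (v j M - v j M') = D j M - D j M'.
  move=> jm MM'; have /Dpyth : v j M \in V j M'.
    by have /subvP -> : (V j M <= V j M')%VS by rewrite V_homo ?leqnn.
  rewrite -/(D j M) => ->; rewrite [RHS]addrC addKr.
  by rewrite -opprB -scaleN1r sipZl sipZr rmorphN1 mulrA mulrNN !mul1r.
have Dhomo j M M' : (j <= m)%N -> (M <= M')%N -> D j M' <= D j M.
  by move=> jm MM'; rewrite -subr_ge0 -Ddiff.
have phi_le u : `|Q phi u| ^+ 2 <= B * Q u u.
  by rewrite (le_trans (sip_CauchySchwarz _ _))// ler_wpM2r.
have first_sum M : \sum_(j < m.+1) `|Q phi (g j - v j M)| ^+ 2 <= B ^+ 2.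
  apply: (@le_trans _ _ (Q phi phi * B)); last by rewrite ler_wpM2r.
  apply: sip_bessel => //; last by move=> i; apply: DB; rewrite -ltnS.
  have lt_case i j : (i < j <= m)%N -> Q (g j - v j M) (g i - v i M) = 0.
    move=> ijm; have /andP[ij jm] := ijm; apply: vo; rewrite memvB ?gV//.
    by have /subvP -> : (V i M <= V j M)%VS by rewrite V_homo// (ltnW ij).
  move=> i j; rewrite neq_ltn => /orP[ij|ji]; last by rewrite lt_case// ji -ltnS/=.
  by rewrite QC lt_case ?conjC0// ij -ltnS/=.
have third_sum M0 : (M0 + m <= m * (k * k.+1 * m.+1))%N ->
    \sum_(j < m.+1) `|Q phi (v j (M0 + (m - j))%N)| ^+ 2 <= B ^+ 2.
  move=> M0L.
  (* [W j] is the squared distance from [xi] to the image of the [j]-th space under [T j]. The value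
     [Q xi xi] at [m.+1] makes the last term [j = m], which has no successor, telescope too. *)
  pose W j := if (j <= m)%N then D j (M0 + (m - j))%N else Q xi xi.
  have W0 j : 0 <= W j by rewrite /W; case: ifP.
  have WE j : (j <= m)%N -> W j = D j (M0 + (m - j))%N by rewrite /W => ->.
  have WS : W m.+1 = Q xi xi by rewrite /W ltnn.
  have bnd j : (j < m.+1)%N ->
      `|Q phi (v j (M0 + (m - j))%N)| ^+ 2 <= B * (W j.+1 - W j).
    rewrite ltnS leq_eqVlt => /orP[/eqP ->|jm].
      rewrite WS WE// (le_trans (phi_le _))// ler_wpM2l// -(gg m)//.
      have := Dpyth m (M0 + (m - m))%N 0 (mem0v _); rewrite !subr0 => ->.
      by rewrite addrAC subrr add0r.
    rewrite (WE j.+1)// (WE j (ltnW jm)).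
    have e : (m - j = (m - j.+1).+1)%N by rewrite subnSK.
    have [|v' [v'V phiv' Tv']] := @shiftV j _ _ jm _ (vV j.+1 (M0 + (m - j.+1))%N).
      by rewrite (leq_trans _ M0L)// -addnS -e leq_add2l leq_subr.
    rewrite -addnS -e in v'V.
    rewrite -[Q phi _]subr0 -phiv' -sipBr (le_trans (phi_le _))// ler_wpM2l//.
    have -> : D j.+1 (M0 + (m - j.+1))%N = Q (g j - v') (g j - v').
      by rewrite /D -(TQ j.+1) -(TQ j (g j - v')) !TB !Tg ?Tv'// ltnW.
    by rewrite (Dpyth _ _ _ v'V) addrAC subrr add0r.
  rewrite -(big_mkord xpredT (fun j => `|Q phi (v j (M0 + (m - j))%N)| ^+ 2)).
  apply: (@le_trans _ _ (\sum_(0 <= j < m.+1) B * (W j.+1 - W j))).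
    by rewrite big_nat [leRHS]big_nat ler_sum// => j /andP[_]; exact: bnd.
  rewrite -mulr_sumr telescope_sumr// ler_wpM2l// WS.
  by rewrite (le_trans _ xiB)// gerBl.
(* A block of [m] levels contains all [M0 + (m - j)]; among [L] blocks there is one where [F] drops
   by at most [B / (k * k.+1)]. *)
pose L := (k * k.+1 * m.+1)%N; pose F l := \sum_(j < m.+1) D j (m * l)%N.
have L0 : (0 < L)%N by rewrite !muln_gt0 k0.
have FB : F 0%N <= m.+1%:R * B.
  apply: (@le_trans _ _ (\sum_(j < m.+1) B)).
    by apply: ler_sum => j _; rewrite DB// -ltnS.
  by rewrite sumr_const card_ord mulr_natl.
have F0 l : 0 <= F l by apply: sumr_ge0 => j _; exact: D0.
have [l lL Fl] := small_decrement L0 F0 FB.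
pose M0 := (m * l)%N.
have M0L : (M0 + m <= m * L)%N by rewrite /M0 -mulnSr leq_mul2l lL orbT.
pose S := \sum_(j < m.+1) `|Q phi (v j M0 - v j (M0 + (m - j))%N)| ^+ 2.
have second_sum : S <= B * (F l - F l.+1).
  rewrite /F -sumrB mulr_sumr ler_sum// => j _; rewrite (le_trans (phi_le _))//.
  have jm : (j <= m)%N by rewrite -ltnS.
  rewrite ler_wpM2l// Ddiff ?leq_addr// lerB// Dhomo// mulnS addnC.
  by rewrite leq_add2r leq_subr.
have second_sum' : (k * k.+1)%:R * S <= B ^+ 2.
  apply: (@le_trans _ _ ((k * k.+1)%:R * (B * (F l - F l.+1)))).
    by rewrite ler_wpM2l.
  rewrite mulrCA expr2 ler_wpM2l//.
  by rewrite -(@ler_pM2l _ m.+1%:R) ?ltr0n// mulrA -natrM mulnC.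
pose a j := Q phi (g j - v j M0); pose c j := Q phi (v j (M0 + (m - j))%N).
pose b j := Q phi (v j M0 - v j (M0 + (m - j))%N).
(* The heavy weight falls on [b], whose sum is small; the three sums add up to [4 * k.+1 + 1] times
   [B ^+ 2]. *)
have abc j : k%:R * `|Q phi (g j)| ^+ 2 <=
    k.+1%:R * (2 * `|a j| ^+ 2 + 2 * `|c j| ^+ 2) + (k * k.+1)%:R * `|b j| ^+ 2.
  have -> : Q phi (g j) = (a j + c j) + b j by rewrite /a /b /c !sipBr; ring.
  rewrite (le_trans (sqr_norm_weighted _ _ k0))// lerD2r ler_wpM2l//.
  by have := sqr_norm_weighted (a j) (c j) (isT : (0 < 1)%N); rewrite mul1r.
rewrite mulr_sumr (le_trans (ler_sum _ (fun (j : 'I_m.+1) _ => abc j)))// big_split /=.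
rewrite -!mulr_sumr big_split /= -!mulr_sumr.
have -> : (4 * k + 5)%:R * B ^+ 2 = k.+1%:R * (2 * B ^+ 2 + 2 * B ^+ 2) + B ^+ 2.
  by rewrite natrD natrM -natr1; ring.
rewrite lerD// ler_wpM2l// lerD// ler_wpM2l//; first exact: first_sum.
exact: third_sum.
Qed.
End Chains.
End SemiInnerProduct.

(** * Roots of unity and monomials on the discrete torus *)

Section RootsOfUnity.
Variables (C : numClosedFieldType) (N : nat) (w : C).

Lemma primitive_root_exists : (0 < N)%N -> exists z : C, N.-primitive_root z.
Proof.
move=> N0; have [r Dp] := closed_field_poly_normal ('X^N - 1 : {poly C}).
have mp : 'X^N - 1 \is @monic C by rewrite monicXnsubC.
rewrite (monicP mp) scale1r in Dp.
have rN1 : all N.-unity_root r by apply/allP => z; rewrite -root_prod_XsubC -Dp.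
have sz_r : (N < (size r).+1)%N.
  by rewrite -(size_prod_XsubC r id) -Dp size_XnsubC.
have [|z] := hasP (has_prim_root N0 rN1 _ sz_r); last by exists z.
by rewrite -separable_prod_XsubC -Dp separable_Xn_sub_1// pnatr_eq0 -lt0n.
Qed.

Hypothesis w_prim : N.-primitive_root w.

Lemma primitive_root_norm : `|w| = 1.
Proof.
have N0 := prim_order_gt0 w_prim; apply/eqP.
by rewrite -(@pexpr_eq1 _ `|w| N)// -normrX (prim_expr_order w_prim) normr1.
Qed.

Lemma primitive_root_neq0 : w != 0.
Proof. by rewrite -normr_eq0 primitive_root_norm oner_neq0. Qed.

Lemma conj_exprz (a : int) : (w ^ a)^* = w ^ (- a).
Proof.
have wV : w^* = w^-1.
  by rewrite invC_norm primitive_root_norm expr1n invr1 mul1r.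
by rewrite rmorphXz ?unitfE ?primitive_root_neq0//= wV exprz_inv.
Qed.

Lemma sum_exprz_eq0 (a : int) : a != 0 -> (`|a| < N)%N ->
  \sum_(k < N) w ^ (k%:Z * a) = 0.
Proof.
move=> a0 aN; have N0 := prim_order_gt0 w_prim; pose q := w ^ a.
have qN : q ^+ N = 1.
  by rewrite /q exprnP exprzAC -exprnP (prim_expr_order w_prim) exp1rz.
have q1 : q - 1 != 0.
  rewrite subr_eq0; apply/negP => /eqP q1.
  have : w ^+ `|a|%N == 1.
    case: a @q a0 aN q1 {qN} => n; rewrite /= /exprz => _ _; first by move=> ->.
    by move=> /(congr1 GRing.inv); rewrite invrK invr1 => ->.
  rewrite -(prim_order_dvd w_prim) => /dvdn_leq.
  by rewrite absz_gt0 a0 leqNgt aN => /(_ isT).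
apply: (mulfI q1); rewrite mulr0.
have := subrX1 q N; rewrite qN subrr => /esym; move=> h.
rewrite -[RHS]h; congr (_ * _); apply: eq_bigr => k _.
by rewrite exprnP /q exprz_exp mulrC.
Qed.

Variable n : nat.

(** A point of the discrete torus is given by the exponents [y] of its coordinates [w ^ y l]. *)
Definition mono (a : 'I_n -> int) (y : {ffun 'I_n -> 'I_N}) : C :=
  \prod_l w ^ ((y l : nat)%:Z * a l).

Lemma monoD a b y : mono (fun l => a l + b l) y = mono a y * mono b y.
Proof.
rewrite -big_split; apply: eq_bigr => l _ /=.
by rewrite mulrDr expfzDr// primitive_root_neq0.
Qed.

Lemma conj_mono a y : (mono a y)^* = mono (fun l => - a l) y.
Proof. by rewrite rmorph_prod; apply: eq_bigr => l _ /=; rewrite conj_exprz mulrN. Qed.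

Lemma sum_mono a : (forall l, `|a l| < N)%N ->
  \sum_y mono a y = if [forall l, a l == 0] then (N ^ n)%:R else 0.
Proof.
move=> aN; rewrite -(bigA_distr_bigA (fun l (k : 'I_N) => w ^ ((k : nat)%:Z * a l))) /=.
case: ifPn => [/forallP a0|/forallPn[l al]].
  rewrite (eq_bigr (fun=> N%:R)) ?prodr_const ?card_ord ?natrX// => l _.
  rewrite (eq_bigr (fun=> 1)) ?sumr_const ?card_ord// => k _.
  by rewrite (eqP (a0 l)) mulr0 expr0z.
by rewrite (bigD1 l)//= sum_exprz_eq0 ?mul0r.
Qed.

End RootsOfUnity.

(* Encodes the coefficients -1, 0 and 1 by 0, 1 and 2. *)
Definition digit (d : 'I_3) : int := (d : nat)%:Z - 1.

(* A walk is a nat-valued sequence [s]; [s i] is the sum of the first [i]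
   coefficients, so the coefficient at the index [l] is [s l.+1 - s l]. *)
Definition walk_incr (n : nat) (s : nat -> nat) (l : 'I_n) : int := (s l.+1)%:Z - (s l)%:Z.

Definition walk (n : nat) (s : nat -> nat) : Prop :=
  [/\ s 0%N = 0%N, s n = 1%N &
      forall i k, (i <= k <= n)%N -> (0 < s i)%N -> (0 < s k)%N].

Definition exceeds1 (n : nat) (s : nat -> nat) : Prop := exists2 i, (i <= n)%N & (1 < s i)%N.

(* The walk leaves 0 before the step [j], or at the step [j] but rises above 1.
   Subtracting the frequency [j.+1] and adding the frequency [j] raises [s j.+1]
   by one: this maps [late_walk n j.+1] into [late_walk n j] and always produces
   a walk that rises above 1. *)
Definition late_walk (n j M : nat) (s : nat -> nat) : Prop :=
  [/\ walk n s, forall i, (i <= n)%N -> (s i <= M.+1)%N &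
      (0 < s j)%N \/ (0 < s j.+1)%N /\ exceeds1 n s].

(** * Spaces spanned by late walks *)

Section WalkSpaces.
Variables (C : numClosedFieldType) (N : nat) (w : C) (w_prim : N.-primitive_root w).
Variable n : nat.
Local Notation X := {ffun 'I_n -> 'I_N}.
Local Notation E := {ffun X -> C^o}.

Definition walk_mono (s : nat -> nat) : E := [ffun y => mono w (@walk_incr n s) y].

(** On [0, ..., n] the walks of [late_walk n j M] are at most [M.+1], so that finite functions to
    ['I_M.+2] index a spanning family. *)
Definition walk_of M (t : {ffun 'I_n.+1 -> 'I_M.+2}) (i : nat) : nat := t (inord i).

Definition walk_space j M : {vspace E} :=
  (\sum_(t : {ffun 'I_n.+1 -> 'I_M.+2} | `[< late_walk n j M (walk_of t) >])
     <[walk_mono (walk_of t)]>)%VS.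

Lemma eq_walk_mono s s' : (forall i, (i <= n)%N -> s i = s' i) ->
  walk_mono s = walk_mono s'.
Proof.
move=> ss; apply/ffunP => y; rewrite !ffunE; apply: eq_bigr => l _.
by rewrite /walk_incr !ss// ltnW.
Qed.

Lemma eq_walk s s' : (forall i, (i <= n)%N -> s i = s' i) -> walk n s -> walk n s'.
Proof.
move=> ss [s0 sn sp]; split; rewrite -?ss// => i k /andP[ik kn].
by rewrite -!ss ?(leq_trans ik)// => /sp -> //; rewrite ik.
Qed.

Lemma mem_walk_space j M s : (j < n)%N -> late_walk n j M s -> walk_mono s \in walk_space j M.
Proof.
move=> jn [ws sM sj].
pose t : {ffun 'I_n.+1 -> 'I_M.+2} := [ffun i : 'I_n.+1 => inord (s i)].
have tE i : (i <= n)%N -> s i = walk_of t i.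
  by move=> iN; rewrite /walk_of ffunE !inordK// ltnS sM.
rewrite (eq_walk_mono tE) (@subvP _ _ <[walk_mono (walk_of t)]> _ _ _ (memv_line _))//.
apply: (sumv_sup t) => //; apply/asboolP; split; first exact: eq_walk ws.
  by move=> i iN; rewrite -tE// sM.
rewrite -!tE ?(ltnW jn)//; case: sj => [|[? [i iN si]]]; first by left.
by right; split=> //; exists i; rewrite -?tE.
Qed.

Lemma walk_spaceP j M v : v \in walk_space j M ->
  exists c : {ffun 'I_n.+1 -> 'I_M.+2} -> C,
    v = \sum_(t : {ffun 'I_n.+1 -> 'I_M.+2} | `[< late_walk n j M (walk_of t) >])
          c t *: walk_mono (walk_of t).
Proof.
move=> /memv_sumP[u uv ->].
have /choice[c cP] (t : {ffun 'I_n.+1 -> 'I_M.+2}) : exists a,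
    `[< late_walk n j M (walk_of t) >] -> u t = a *: walk_mono (walk_of t).
  have [/uv/vlineP[a ->]|_] := boolP `[< late_walk n j M (walk_of t) >]; last by exists 0.
  by exists a.
by exists c; apply: eq_bigr => t /cP.
Qed.

Lemma walk_space_homo i j M M' : (i <= j)%N -> (j < n)%N -> (M <= M')%N ->
  (walk_space i M <= walk_space j M')%VS.
Proof.
move=> ij jn MM'; apply/subv_sumP => t /asboolP[wt tM tj].
rewrite -memvE; apply: mem_walk_space => //; split=> //.
  by move=> k kn; rewrite (leq_trans (tM _ kn)).
have [_ _ tp] := wt.
move: ij; rewrite leq_eqVlt => /orP[/eqP <-//|ij]; left.
case: tj => [ti|[ti _]].
  by apply: tp ti; rewrite (ltnW ij) ltnW.
by apply: tp ti; rewrite ij ltnW.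
Qed.

(** Its only nonzero increment is a 1 at [i]: its monomial is the [i]-th coordinate. *)
Definition step_walk (i : nat) (j : nat) : nat := (i < j)%N.

Lemma step_walk_mem i j M : (i < j)%N -> (j < n)%N -> walk_mono (step_walk i) \in walk_space j M.
Proof.
move=> ij jn; apply: mem_walk_space => //; split; last by left; rewrite /step_walk ij.
  split; rewrite /step_walk ?(ltn_trans ij jn)// => k l /andP[kl _].
  by rewrite !lt0b => /leq_trans; apply.
by move=> k _; rewrite /step_walk; case: ltngtP.
Qed.

Definition bump_walk (j : nat) (s : nat -> nat) (i : nat) : nat := (s i + (i == j.+1))%N.

(** If [s j.+1] is positive, the bump lifts it above 1. Otherwise [s] exceeds 1 anyway and is
    positive from [j.+2] on, so that the new positive value at [j.+1] is not followed by 0. *)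
Lemma bump_walk_late j M s : (j.+1 < n)%N -> late_walk n j.+1 M s ->
  late_walk n j M.+1 (bump_walk j s) /\ exceeds1 n (bump_walk j s).
Proof.
move=> jn [[s0 sn sp] sM sj].
have ex : exceeds1 n (bump_walk j s).
  case: sj => [sj|[_ [i iN si]]].
    by exists j.+1; [exact: ltnW|rewrite /bump_walk eqxx addn1 ltnS].
  by exists i => //; rewrite /bump_walk (leq_trans si)// leq_addr.
split=> //; split; last first.
- by right; split=> //; rewrite /bump_walk eqxx addn1.
- move=> i iN; rewrite /bump_walk -[leqRHS]addn1 leq_add ?sM//; by case: eqP.
split; rewrite /bump_walk ?s0 ?sn// ?(gtn_eqF jn)//.
move=> i k /andP[ik kn]; rewrite !addn_gt0 !lt0b => /orP[si|/eqP ij].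
  by rewrite (sp i k)// ik.
rewrite ij in ik.
case: sj => [sj|[sj _]]; first by rewrite (sp j.+1 k)// ik.
move: ik; rewrite leq_eqVlt => /orP[/eqP <-|ik]; first by rewrite eqxx orbT.
by rewrite (sp j.+2 k)// ik.
Qed.

Lemma mono_bump_walk j s (jn : (j.+1 < n)%N) (y : X) :
  mono w (@walk_incr n (bump_walk j s)) y =
  w ^ (y (Ordinal (ltnW jn)) : nat) * (w ^ (y (Ordinal jn) : nat))^* * mono w (@walk_incr n s) y.
Proof.
pose d (i : nat) (l : 'I_n) : int := ((l : nat) == i)%:Z.
have dE (i : nat) (iN : (i < n)%N) : mono w (d i) y = w ^ (y (Ordinal iN) : nat).
  rewrite /mono (bigD1 (Ordinal iN))//= big1 ?mulr1 => [|l lj].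
    by rewrite /d eqxx mulr1.
  by rewrite /d -val_eqE/= in lj *; rewrite (negPf lj) mulr0 expr0z.
rewrite -!dE (conj_mono w_prim) -!(monoD w_prim).
apply: eq_bigr => l _; congr (_ ^ (_ * _)).
rewrite /walk_incr /bump_walk /d eqSS !PoszD.
by rewrite opprD addrACA addrC.
Qed.

End WalkSpaces.

(** * A Paley inequality for polynomials with exponents -1, 0 and 1 *)

Section DigitPolynomials.
Variables (C : numClosedFieldType) (m : nat).
Local Notation n := m.+1.
Variable c : {ffun 'I_n -> 'I_3} -> C.

Definition digit_poly N (w : C) (y : {ffun 'I_n -> 'I_N}) : C :=
  \sum_e c e * mono w (fun l => digit (e l)) y.

Definition unit_digits (l : 'I_n) : {ffun 'I_n -> 'I_3} :=
  [ffun i => if i == l then inord 2 else inord 1].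

Lemma digit_bound d : (`|digit d| <= 1)%N.
Proof. by case: d => -[|[|[|//]]] ?. Qed.

Lemma digit_inj : injective digit.
Proof. by move=> d d' /addIr [] /val_inj. Qed.

Lemma digit_unit_digits l i : digit (unit_digits l i) = walk_incr (step_walk l) i.
Proof.
rewrite ffunE /digit /walk_incr /step_walk ltnS.
case: eqVneq => [->|il]; first by rewrite inordK// leqnn ltnn.
have : (i : nat) != l by [].
by rewrite inordK//; case: ltngtP.
Qed.

(** Orthogonality of monomials: [a l] minus a digit stays below [N] in absolute value. At most one
    [e] contributes on the right, and none if some [a l] is not a digit. *)
Lemma digit_poly_coef N (w : C) (a : 'I_n -> int) : N.-primitive_root w ->
  (forall l, `|a l|.+1 < N)%N ->
  \sum_(y : {ffun 'I_n -> 'I_N}) (digit_poly w y)^* * mono w a y =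
  (N ^ n)%:R * \sum_(e : {ffun 'I_n -> 'I_3} | [forall l, digit (e l) == a l]) (c e)^*.
Proof.
move=> wp aN; rewrite [in RHS]big_mkcond mulr_sumr.
transitivity (\sum_(y : {ffun 'I_n -> 'I_N})
    \sum_e (c e)^* * mono w (fun l => a l - digit (e l)) y).
  apply: eq_bigr => y _; rewrite rmorph_sum mulr_suml; apply: eq_bigr => e _.
  by rewrite rmorphM /= (conj_mono wp) (monoD wp) -mulrA [mono w a y * _]mulrC.
rewrite exchange_big; apply: eq_bigr => e _ /=.
rewrite -mulr_sumr (sum_mono wp) => [|l].
  have -> : [forall l, a l - digit (e l) == 0] = [forall l, digit (e l) == a l].
    by apply: eq_forallb => l; rewrite subr_eq0 eq_sym.
  by case: ifP; rewrite ?mulr0// mulrC.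
move: (digit_bound (e l)) (aN l); move: (digit _) (a l) => x z; lia.
Qed.

Variables (B : C) (k : nat).
Hypothesis k0 : (0 < k)%N.
Hypothesis digit_poly_le : forall N (w : C), (1 < N)%N -> N.-primitive_root w ->
  \sum_y `|digit_poly (N := N) w y| <= (N ^ n)%:R * B.
Hypothesis c_eq0 : forall (e : {ffun 'I_n -> 'I_3}) s, walk n s -> exceeds1 n s ->
  (forall l, digit (e l) = walk_incr s l) -> c e = 0.

(** [chain_bound] is applied in [L^2(|f|)] over the discrete torus. Since [phi |f| = f], pairing
    with [phi] reads off conjugate coefficients of [f]: those of the coordinates, and 0 on the walks
    that exceed 1. *)
Lemma digit_poly_paley :
  k%:R * \sum_(l < n) `|c (unit_digits l)| ^+ 2 <= (4 * k + 5)%:R * B ^+ 2.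
Proof.
(* N exceeds every difference of two frequencies that occur, so that no
   frequency wraps around. *)
pose Mx := (m * (k * k.+1 * m.+1))%N; pose N := Mx.+4.
have [w wp] := @primitive_root_exists C N isT.
pose f := @digit_poly N w.
pose X := {ffun 'I_n -> 'I_N}.
have Nn0 : ((N ^ n)%:R : C) != 0 by rewrite pnatr_eq0 expn_eq0.
have Nn_gt0 : 0 < (N ^ n)%:R^-1 :> C by rewrite invr_gt0 ltr0n expn_gt0.
pose Q (p q : {ffun X -> C^o}) : C := (N ^ n)%:R^-1 * \sum_y `|f y| * ((p y)^* * q y).
have QP p a q r : Q p (a *: q + r) = a * Q p q + Q p r.
  rewrite /Q mulrCA -mulrDr; congr (_ * _); rewrite mulr_sumr -big_split /=.
  by apply: eq_bigr => y _; rewrite !ffunE; rewrite /GRing.scale/=; ring.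
have QC p q : Q q p = (Q p q)^*.
  rewrite /Q rmorphM /= fmorphV rmorph_nat rmorph_sum; congr (_ * _).
  apply: eq_bigr => y _; rewrite !rmorphM /= conjCK (conj_Creal (normr_real _)).
  by rewrite [p y * _]mulrC.
have Qge0 p : 0 <= Q p p.
  rewrite mulr_ge0 ?(ltW Nn_gt0)// sumr_ge0// => y _.
  by rewrite mulr_ge0// mulrC mul_conjC_ge0.
have fB : (N ^ n)%:R^-1 * \sum_y `|f y| <= B.
  by rewrite ler_pdivrMl ?ltr0n ?expn_gt0//; exact: digit_poly_le.
(* Where [f] vanishes, [phi] is 0; the weight [|f|] of the form is 0 there as well. *)
pose phi : {ffun X -> C^o} := [ffun y => f y / `|f y|].
pose xi : {ffun X -> C^o} := [ffun=> 1].
have normM_conj_sgn (u : C) : `|u| * (u / `|u|)^* = u^*.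
  rewrite fmorph_div /= (conj_Creal (normr_real u)) mulrC.
  have [->|u0] := eqVneq u 0; first by rewrite normr0 mulr0 conjC0.
  by rewrite divfK ?normr_eq0.
have phiE q : Q phi q = (N ^ n)%:R^-1 * \sum_y (f y)^* * q y.
  rewrite /Q; congr (_ * _); apply: eq_bigr => y _.
  by rewrite ffunE mulrA normM_conj_sgn.
have xiB : Q xi xi <= B.
  rewrite (le_trans _ fB)// /Q ler_wpM2l ?(ltW Nn_gt0)// ler_sum// => y _.
  by rewrite !ffunE conjC1 !mulr1.
have phiB : Q phi phi <= B.
  rewrite (le_trans _ fB)// phiE ler_wpM2l ?(ltW Nn_gt0)// ler_sum// => y _.
  rewrite ffunE mulrA [_^* * _]mulrC -normCK expr2.
  by have [->|fy0] := eqVneq `|f y| 0; rewrite ?mul0r// mulfK.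
pose z (j : nat) (y : X) : C := w ^ (y (inord j) : nat).
have zz j y : z j y * (z j y)^* = 1.
  by rewrite (conj_exprz wp) -expfzDr ?(primitive_root_neq0 wp)// subrr expr0z.
(* An isometry, the coordinates having modulus 1; it sends the [j]-th one to [xi]. *)
pose T (j : nat) (u : {ffun X -> C^o}) : {ffun X -> C^o} := [ffun y => (z j y)^* * u y].
pose V j M := walk_space N w n j M.
pose g i : {ffun X -> C^o} := walk_mono N w n (step_walk i).
have gE i y : (i <= m)%N -> g i y = z i y.
  move=> im; rewrite ffunE /mono (bigD1 (inord i))//= big1 => [|l li].
    by rewrite mulr1 /walk_incr /step_walk inordK// ltnSn ltnn subr0 mulr1.
  rewrite /walk_incr /step_walk ltnS; have : (l : nat) != i.
    by apply: contraNneq li => <-; rewrite inord_val.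
  by case: ltngtP => // _ _; rewrite subrr mulr0 expr0z.
have phig (l : 'I_n) : Q phi (g l) = (c (unit_digits l))^*.
  rewrite phiE; under eq_bigr do rewrite ffunE.
  rewrite (digit_poly_coef wp) => [|i]; last first.
    by rewrite -digit_unit_digits; have := digit_bound (unit_digits l i); rewrite /N; lia.
  rewrite mulKf// (big_pred1 (unit_digits l)) => // e.
  apply/forallP/eqP => [h|-> i]; last by rewrite digit_unit_digits.
  by apply/ffunP => i; apply: digit_inj; rewrite (eqP (h i)) digit_unit_digits.
have phi0 s : walk n s -> (forall i, (i <= n)%N -> (s i <= Mx.+1)%N) -> exceeds1 n s ->
    Q phi (walk_mono N w n s) = 0.
  move=> ws sM es; rewrite phiE; under eq_bigr do rewrite ffunE.
  rewrite (digit_poly_coef wp) => [|l]; last first.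
    have := sM _ (ltn_ord l); have := sM _ (ltnW (ltn_ord l)).
    by rewrite /walk_incr /N; lia.
  rewrite big1 ?mulr0// => e /forallP h.
  by rewrite (c_eq0 ws es) ?conjC0// => l; exact/eqP.
have := @chain_bound C {ffun X -> C^o} Q QP QC Qge0 phi xi B m g T V k phiB xiB k0.
under eq_bigr => l _ do rewrite phig norm_conjC.
apply => //.
- by move=> j u v; apply/ffunP => y; rewrite !ffunE mulrBr.
- move=> j u v; rewrite /Q; congr (_ * _); apply: eq_bigr => y _; rewrite !ffunE.
  rewrite rmorphM /= conjCK; congr (_ * _).
  by rewrite mulrACA zz mul1r.
- by move=> j jm; apply/ffunP => y; rewrite [LHS]ffunE gE// mulrC zz ffunE.
- by move=> i j M M' /andP[ij jm] MM'; exact: walk_space_homo.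
- by move=> i j M /andP[ij jm]; exact: step_walk_mem.
move=> j M v jm MMx /walk_spaceP[a ->].
(* Bumping every walk multiplies [v] by coordinate [j] and by the conjugate of coordinate [j.+1],
   which [T j] and [T j.+1] compensate. All the bumped walks exceed 1, so [phi] is orthogonal to
   [v']. *)
pose v' := \sum_(t : {ffun 'I_n.+1 -> 'I_M.+2} | `[< late_walk n j.+1 M (walk_of t) >])
   a t *: walk_mono N w n (bump_walk j (walk_of t)).
exists v'; split.
- apply: memv_suml => t /asboolP ht; rewrite memvZ//.
  have [lt _] := bump_walk_late (jm : (j.+1 < n)%N) ht.
  by apply: mem_walk_space lt; exact: ltnW.
- apply: (big_ind (fun u => Q phi u = 0)) => [|u u' u0 u'0|t /asboolP ht].
  + exact: sip0r QP _.
  + by rewrite (sipDr QP) u0 u'0 addr0.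
  have [[wt tM _] et] := bump_walk_late (jm : (j.+1 < n)%N) ht.
  rewrite (sipZr QP) phi0 ?mulr0// => i iN.
  by rewrite (leq_trans (tM _ iN))// !ltnS.
apply/ffunP => y; rewrite !ffunE !sum_ffunE !mulr_sumr; apply: eq_bigr => t _.
rewrite !ffunE (mono_bump_walk wp _ (jm : (j.+1 < n)%N)) /GRing.scale/=.
have zE i (iN : (i < n)%N) : w ^ (y (Ordinal iN) : nat) = z i y.
  by rewrite /z; congr (w ^ (nat_of_ord (y _))); apply: val_inj; rewrite /= inordK.
rewrite !zE -[RHS]mul1r -(zz j y); move: (mono _ _ _) => u.
by move: (z j y) (z j.+1 y) ((z j y)^*) ((z j.+1 y)^*) (a t) => *; ring.
Qed.
End DigitPolynomials.

(** * Integration against a charge *)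

Section ChargeIntegral.
Context d (T : measurableType d) (R : realType).
Implicit Types (f g : T -> R) (nu : {charge set T -> \bar R}).

Definition bounded_measurable f :=
  measurable_fun setT f /\ exists c, forall x, `|f x| <= c.

Lemma bounded_measurable_cst (a : R) : bounded_measurable (fun=> a).
Proof. by split; [exact: measurable_cst|exists `|a|]. Qed.

Lemma bounded_measurable_indic A : measurable A -> bounded_measurable (\1_A : T -> R).
Proof.
move=> mA; split; first exact: measurable_indic.
by exists 1 => x; rewrite indicE normr_nat lern1 leq_b1.
Qed.

Lemma bounded_measurableD f g : bounded_measurable f -> bounded_measurable g ->
  bounded_measurable (fun x => f x + g x).
Proof.
move=> [mf [a fa]] [mg [b gb]]; split; first exact: measurable_funD.
by exists (a + b) => x; rewrite (le_trans (ler_normD _ _))// lerD.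
Qed.

Lemma bounded_measurableM f g : bounded_measurable f -> bounded_measurable g ->
  bounded_measurable (fun x => f x * g x).
Proof.
move=> [mf [a fa]] [mg [b gb]]; split; first exact: measurable_funM.
by exists (a * b) => x; rewrite normrM ler_pM.
Qed.

Lemma bounded_measurable_integrable (mu : {finite_measure set T -> \bar R}) f :
  bounded_measurable f -> mu.-integrable setT (EFin \o f).
Proof.
move=> [mf [c fc]]; apply: measurable_bounded_integrable => //.
  by rewrite ltey_eq fin_num_measure.
by exists c; split; rewrite ?num_real// => M cM x _; exact: le_trans (fc x) (ltW cM).
Qed.

Lemma charge_integralD nu f g : bounded_measurable f -> bounded_measurable g ->
  charge_integral nu (fun x => f x + g x) = charge_integral nu f + charge_integral nu g.
Proof.
move=> bf bg; rewrite /charge_integral.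
rewrite !RintegralD//; try exact: bounded_measurable_integrable.
by rewrite opprD addrACA.
Qed.

Lemma charge_integralZ nu (a : R) f : bounded_measurable f ->
  charge_integral nu (fun x => a * f x) = a * charge_integral nu f.
Proof.
move=> bf; rewrite /charge_integral.
rewrite !RintegralZl//; try exact: bounded_measurable_integrable.
by rewrite mulrBr.
Qed.

Lemma charge_integral_indic nu A : measurable A ->
  charge_integral nu \1_A = fine (nu A).
Proof.
move=> mA; rewrite /charge_integral.
move: (projT2 (cid (projT2 (cid (Hahn_decomposition nu))))) => nuPN.
rewrite /Rintegral !integral_indic// !setIT (jordan_decomp nuPN mA).
rewrite /cadd/= /cscale/= EFinN mulN1e -fineB//; exact: fin_num_measure.
Qed.

Lemma charge_integral_le nu : exists2 C : R, 0 <= C & forall f (c : R),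
  bounded_measurable f -> (forall x, `|f x| <= c) -> `|charge_integral nu f| <= C * c.
Proof.
rewrite /charge_integral; move: (projT2 (cid (projT2 (cid (Hahn_decomposition nu))))) => nuPN.
exists (fine (jordan_pos nuPN setT) + fine (jordan_neg nuPN setT)).
  by rewrite addr_ge0// fine_ge0.
move=> f c bf fc.
have bnd (mu : {finite_measure set T -> \bar R}) :
    `|\int[mu]_x f x| <= fine (mu setT) * c.
  rewrite (le_trans (le_normr_Rintegral _ (bounded_measurable_integrable mu bf)))//.
  apply: (@le_trans _ _ (\int[mu]_x c)).
    apply: le_Rintegral => //.
    - by have /integrable_norm := bounded_measurable_integrable mu bf.
    - have h := bounded_measurable_integrable mu (bounded_measurable_cst c).
      exact: h.
  rewrite /Rintegral (integral_cst mu measurableT c%:E) fineM ?fin_num_measure//.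
  by rewrite mulrC.
by rewrite (le_trans (ler_normB _ _))// mulrDl lerD//; exact: bnd.
Qed.
End ChargeIntegral.


(** * Integration against a complex measure *)

Section ComplexIntegral.
Context d (T : measurableType d) (R : realType).
Implicit Types (f g : T -> R[i]) (mu : complex_measure T R).

Lemma ReD (x y : R[i]) : complex.Re (x + y) = complex.Re x + complex.Re y.
Proof. by case: x; case: y. Qed.

Lemma ImD (x y : R[i]) : complex.Im (x + y) = complex.Im x + complex.Im y.
Proof. by case: x; case: y. Qed.

Lemma ReM (x y : R[i]) : complex.Re (x * y) =
  complex.Re x * complex.Re y + - complex.Im x * complex.Im y.
Proof. by case: x => a b; case: y => c e /=; rewrite mulNr. Qed.

Lemma ImM (x y : R[i]) : complex.Im (x * y) =
  complex.Re x * complex.Im y + complex.Im x * complex.Re y.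
Proof. by case: x => a b; case: y => c e. Qed.

Lemma normc_le_ReIm (z : R[i]) : normc z <= `|complex.Re z| + `|complex.Im z|.
Proof.
case: z => a b /=; rewrite -[leRHS]ger0_norm ?addr_ge0// -sqrtr_sqr ler_wsqrtr//.
by rewrite sqrrD !real_normK ?num_real// addrAC lerDl mulrn_wge0// mulr_ge0.
Qed.

Definition bounded_measurableC f :=
  bounded_measurable (@complex.Re R \o f) /\ bounded_measurable (@complex.Im R \o f).

Lemma bounded_measurableC_cst (a : R[i]) : bounded_measurableC (fun=> a).
Proof. by split; exact: bounded_measurable_cst. Qed.

Lemma bounded_measurableCD f g : bounded_measurableC f -> bounded_measurableC g ->
  bounded_measurableC (fun x => f x + g x).
Proof.
move=> [rf jf] [rg jg]; split.
  rewrite (_ : _ \o _ = fun x => complex.Re (f x) + complex.Re (g x)).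
    exact: bounded_measurableD.
  by apply/funext => x /=; exact: ReD.
rewrite (_ : _ \o _ = fun x => complex.Im (f x) + complex.Im (g x)).
  exact: bounded_measurableD.
by apply/funext => x /=; exact: ImD.
Qed.

Lemma bounded_measurableCM f g : bounded_measurableC f -> bounded_measurableC g ->
  bounded_measurableC (fun x => f x * g x).
Proof.
move=> [rf jf] [rg jg]; split.
  rewrite (_ : _ \o _ = fun x => complex.Re (f x) * complex.Re (g x) +
      (-1) * (complex.Im (f x) * complex.Im (g x))).
    apply: bounded_measurableD; first exact: bounded_measurableM.
    apply: bounded_measurableM; first exact: bounded_measurable_cst.
    exact: bounded_measurableM.
  by apply/funext => x /=; rewrite ReM mulN1r mulNr.
rewrite (_ : _ \o _ = fun x => complex.Re (f x) * complex.Im (g x) +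
    complex.Im (f x) * complex.Re (g x)).
  by apply: bounded_measurableD; exact: bounded_measurableM.
by apply/funext => x /=; exact: ImM.
Qed.

Lemma bounded_measurableC_sum (I : finType) (F : I -> T -> R[i]) :
  (forall i, bounded_measurableC (F i)) ->
  bounded_measurableC (fun x => \sum_i F i x).
Proof.
move=> bF; elim: (index_enum I) => [|i s IHs].
  rewrite (_ : (fun _ => _) = fun=> 0); first exact: bounded_measurableC_cst.
  by apply/funext => x; rewrite big_nil.
rewrite (_ : (fun _ => _) = fun x => F i x + \sum_(j <- s) F j x).
  exact: bounded_measurableCD.
by apply/funext => x; rewrite big_cons.
Qed.

Lemma cmeasure_integralD mu f g : bounded_measurableC f -> bounded_measurableC g ->
  cmeasure_integral mu (fun x => f x + g x) =
  cmeasure_integral mu f + cmeasure_integral mu g.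
Proof.
move=> [rf jf] [rg jg]; rewrite /cmeasure_integral.
have -> : (fun x => complex.Re (f x + g x)) = fun x => complex.Re (f x) + complex.Re (g x).
  by apply/funext => x; exact: ReD.
have -> : (fun x => complex.Im (f x + g x)) = fun x => complex.Im (f x) + complex.Im (g x).
  by apply/funext => x; exact: ImD.
rewrite !charge_integralD//; apply/eqP; rewrite eq_complex /=.
by apply/andP; split; apply/eqP; ring.
Qed.

Lemma cmeasure_integralZ mu (a : R[i]) f : bounded_measurableC f ->
  cmeasure_integral mu (fun x => a * f x) = a * cmeasure_integral mu f.
Proof.
move=> [rf jf]; rewrite /cmeasure_integral.
have ZE (nu : {charge set T -> \bar R}) (b c : R) (u v : T -> R) :
    bounded_measurable u -> bounded_measurable v ->
    charge_integral nu (fun x => b * u x + c * v x) =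
    b * charge_integral nu u + c * charge_integral nu v.
  move=> bu bv; rewrite charge_integralD ?charge_integralZ//.
    by apply: bounded_measurableM => //; exact: bounded_measurable_cst.
  by apply: bounded_measurableM => //; exact: bounded_measurable_cst.
have -> : (fun x => complex.Re (a * f x)) =
    fun x => complex.Re a * complex.Re (f x) + - complex.Im a * complex.Im (f x).
  by apply/funext => x; exact: ReM.
have -> : (fun x => complex.Im (a * f x)) =
    fun x => complex.Re a * complex.Im (f x) + complex.Im a * complex.Re (f x).
  by apply/funext => x; exact: ImM.
rewrite !ZE//; apply/eqP; rewrite eq_complex /=; case: a => a b /=.
by apply/andP; split; apply/eqP; ring.
Qed.

Lemma cmeasure_integral_sum mu (I : finType) (a : I -> R[i]) (F : I -> T -> R[i]) :
  (forall i, bounded_measurableC (F i)) ->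
  cmeasure_integral mu (fun x => \sum_i a i * F i x) =
  \sum_i a i * cmeasure_integral mu (F i).
Proof.
move=> bF; have baF i : bounded_measurableC (fun x => a i * F i x).
  by apply: bounded_measurableCM => //; exact: bounded_measurableC_cst.
suff [] : bounded_measurableC (fun x => \sum_i a i * F i x) /\
  cmeasure_integral mu (fun x => \sum_i a i * F i x) =
  \sum_i a i * cmeasure_integral mu (F i) by [].
elim: (index_enum I) => [|i s [bs IHs]].
  rewrite big_nil (_ : (fun _ => _) = fun=> 0 * 0); last first.
    by apply/funext => x; rewrite big_nil mul0r.
  have b0 := bounded_measurableC_cst 0; split; last by rewrite cmeasure_integralZ// mul0r.
  exact: bounded_measurableC_cst.
rewrite big_cons (_ : (fun _ => _) = fun x => a i * F i x + \sum_(j <- s) a j * F j x).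
  by split; [exact: bounded_measurableCD|rewrite cmeasure_integralD// IHs cmeasure_integralZ].
by apply/funext => x; rewrite big_cons.
Qed.

Lemma bounded_measurableC_indic A : measurable A ->
  bounded_measurableC (fun x => (\1_A x)%:C).
Proof.
by move=> mA; split; [exact: bounded_measurable_indic|exact: bounded_measurable_cst].
Qed.

Lemma cmeasure_integral_indic mu A : measurable A ->
  cmeasure_integral mu (fun x => (\1_A x)%:C) = mu A.
Proof.
move=> mA; rewrite /cmeasure_integral /=.
have c0 (nu : {charge set T -> \bar R}) : charge_integral nu (fun=> 0) = 0.
  have h := charge_integralZ nu 0 (bounded_measurable_cst T (0 : R)).
  by rewrite mul0r in h; rewrite h mul0r.
rewrite !c0 subr0 add0r !charge_integral_indic//=.
by rewrite /cmeasure_Re /cmeasure_Im /charge_part /=; case: (mu A).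
Qed.

(** A crude constant suffices here: it controls the approximation error in the proof of the sharp
    bound by the total variation. *)
Lemma cmeasure_integral_le mu : exists2 C : R, 0 <= C & forall f (c : R),
  bounded_measurableC f -> (forall x, normc (f x) <= c) ->
  normc (cmeasure_integral mu f) <= C * c.
Proof.
have [C1 C10 C1P] := charge_integral_le (cmeasure_Re mu).
have [C2 C20 C2P] := charge_integral_le (cmeasure_Im mu).
exists (2 * (C1 + C2)); first by rewrite mulr_ge0// addr_ge0.
move=> f c [rf jf] fc; rewrite (le_trans (normc_le_ReIm _))//=.
have rfc x : `|complex.Re (f x)| <= c by rewrite (le_trans (normr_Re_le _)).
have jfc x : `|complex.Im (f x)| <= c by rewrite (le_trans (normr_Im_le _)).
have := C1P _ _ rf rfc; have := C1P _ _ jf jfc.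
have := C2P _ _ rf rfc; have := C2P _ _ jf jfc => h1 h2 h3 h4.
rewrite (le_trans (lerD (ler_normB _ _) (ler_normD _ _)))//.
by rewrite (le_trans (lerD (lerD h4 h1) (lerD h3 h2)))//; lra.
Qed.

End ComplexIntegral.

(** * The integral is bounded by the total variation *)

Section VariationBound.
Context d (T : measurableType d) (R : realType).

(** The cells are the level sets of the integer part of [(u + c) / h], where [c] bounds [|u|]. *)
Lemma bounded_measurable_cells (u : T -> R) (h : R) : bounded_measurable u -> 0 < h ->
  exists (n : nat) (q : T -> 'I_n), (forall i, measurable [set x | q x = i]) /\
    forall x y, q x = q y -> `|u x - u y| <= h.
Proof.
move=> [mu [c uc]] h0; pose v x := h^-1 * (u x + c).
have v0 x : 0 <= v x.
  rewrite mulr_ge0 ?invr_ge0 ?(ltW h0)//.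
  by have := uc x; rewrite ler_norml => /andP[+ _]; rewrite -subr_ge0 opprK.
have vc x : (Num.truncn (v x) < (Num.truncn (h^-1 * (c + c))).+1)%N.
  rewrite ltnS le_truncn// ler_wpM2l ?invr_ge0 ?(ltW h0)// lerD2r.
  by rewrite (le_trans (ler_norm _)).
exists _, (fun x => Ordinal (vc x)); split => [i|x y [xy]].
  rewrite (_ : [set x | _] = v @^-1` `[(i : nat)%:R, (i : nat).+1%:R[).
    rewrite -[X in measurable X]setTI.
    have mv : measurable_fun setT v.
      by apply: measurable_funM => //; apply: measurable_funD.
    exact: (mv measurableT).
  apply/seteqP; split => x /=.
    by move=> <-; rewrite in_itv /= truncn_itv.
  by rewrite in_itv /= => xi; apply: val_inj => /=; exact: truncn_def.
have := truncn_itv (v0 x); have := truncn_itv (v0 y); rewrite xy.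
set k := Num.truncn _ => /andP[ky yk] /andP[kx xk].
have -> : u x - u y = h * (v x - v y).
  by rewrite /v -mulrBr mulrA divff ?gt_eqF// mul1r; ring.
rewrite normrM gtr0_norm// -[leRHS]mulr1 ler_wpM2l ?(ltW h0)// ler_norml.
by rewrite -natr1 in xk yk; apply/andP; split; lra.
Qed.

Lemma normc_sum_le (I : finType) (F : I -> R[i]) :
  normc (\sum_i F i) <= \sum_i normc (F i).
Proof.
elim/big_rec2: _ => [|i x y _ yx]; first by rewrite normc0.
by rewrite (le_trans (le_normcD _ _))// lerD2l.
Qed.

Lemma cmeasure_norm_ge (mu : complex_measure T R) (I : finType) (q : T -> I) :
  (forall i, measurable [set x | q x = i]) ->
  ((\sum_i normc (mu [set x | q x = i]))%:E <= cmeasure_norm mu)%E.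
Proof.
move=> mq; apply: ereal_sup_ubound => /=.
exists #|I|, (fun i => [set x | q x = enum_val i]); split => //.
- apply/trivIsetP => i j _ _ ij; apply/seteqP; split => // x [/= ->].
  by move=> /enum_val_inj/eqP; rewrite (negPf ij).
- by apply/seteqP; split => // x _; exists (enum_rank (q x)) => //=; rewrite enum_rankK.
- by rewrite sumEFin (reindex _ (onW_bij _ (enum_val_bij I))).
Qed.

(** For a simple function this is the triangle inequality over a partition. Within [2 * h] of [f]
    there is a simple function [s], constant on the common cells of the real and imaginary parts. *)
Lemma cmeasure_integral_le_norm (mu : complex_measure T R) (f : T -> R[i]) (c r : R) :
  bounded_measurableC f -> (forall x, normc (f x) <= c) -> cmeasure_norm mu = r%:E ->
  normc (cmeasure_integral mu f) <= c * r.
Proof.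
move=> bf fc mur; have [C C0 CP] := cmeasure_integral_le mu.
(* Thanks to [C + 1], [h] makes sense even for [C = 0], and [C * (2 * h) <= e]. *)
apply/ler_addgt0Pr => e e0; pose h := e / (2 * (C + 1)).
have h0 : 0 < h by rewrite divr_gt0// mulr_gt0// ltr_wpDl.
have [n1 [q1 [mq1 uq1]]] := bounded_measurable_cells bf.1 h0.
have [n2 [q2 [mq2 uq2]]] := bounded_measurable_cells bf.2 h0.
pose q x := (q1 x, q2 x); pose F i := [set x | q x = i].
have mF i : measurable (F i).
  rewrite (_ : F i = [set x | q1 x = i.1] `&` [set x | q2 x = i.2]).
    exact: measurableI.
  by apply/seteqP; split => [x <-//|x [/= x1 x2]]; rewrite /F /q /= x1 x2 -surjective_pairing.
(* A sample of [f] in each cell; for an empty cell it is the value at [point], still of modulus at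
   most [c]. *)
pose z i := f (xget point (F i)).
pose s x := \sum_i z i * (\1_(F i) x)%:C.
have sE x : s x = z (q x).
  rewrite /s (bigD1 (q x))//= big1 ?addr0 => [|i iqx].
    by rewrite indicE mem_set ?mulr1.
  by rewrite indicE memNset ?mulr0//= => /esym/eqP; rewrite (negPf iqx).
have bF i : bounded_measurableC (fun x => (\1_(F i) x : R)%:C).
  exact: bounded_measurableC_indic.
have bs : bounded_measurableC s.
  apply: bounded_measurableC_sum => i; apply: bounded_measurableCM => //.
  exact: bounded_measurableC_cst.
pose g x := f x + (-1) * s x.
have bNs : bounded_measurableC (fun x => -1 * s x).
  by apply: bounded_measurableCM => //; exact: bounded_measurableC_cst.
have bg : bounded_measurableC g by exact: bounded_measurableCD.
have fE : f = (fun x => s x + g x).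
  by apply/funext => x; rewrite /g mulN1r addrC subrK.
have gh x : normc (g x) <= 2 * h.
  have qx : q (xget point (F (q x))) = q x.
    by have : F (q x) (xget point (F (q x))) by apply: xgetPex; exists x.
  case: qx => qx1 qx2.
  rewrite /g sE mulN1r (le_trans (normc_le_ReIm _))// [leRHS]mulr_natl mulr2n.
  rewrite ReD ImD !raddfN/= lerD//; [exact: uq1|exact: uq2].
rewrite fE cmeasure_integralD// (le_trans (le_normcD _ _))// lerD//.
  rewrite cmeasure_integral_sum//; under eq_bigr do rewrite cmeasure_integral_indic//.
  rewrite (le_trans (normc_sum_le _))//.
  apply: (@le_trans _ _ (\sum_i c * normc (mu (F i)))).
    apply: ler_sum => i _; rewrite normcM ler_wpM2r//; last exact: fc.
    by case: (mu _) => a b; exact: sqrtr_ge0.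
  rewrite -mulr_sumr ler_wpM2l//.
    by rewrite (le_trans _ (fc point))//; case: (f _) => a b; exact: sqrtr_ge0.
  by rewrite -lee_fin -mur; exact: cmeasure_norm_ge.
rewrite (le_trans (CP _ _ bg gh))// /h.
have C1 : 0 < C + 1 by rewrite ltr_wpDl.
have -> : C * (2 * (e / (2 * (C + 1)))) = e * (C / (C + 1)).
  by field; rewrite gt_eqF.
by rewrite -[leRHS]mulr1 ler_wpM2l ?(ltW e0)// ler_pdivrMr// mul1r lerDl.
Qed.

End VariationBound.

(** * Characters as measurable functions on the dual group *)

Lemma normc_norm (R : rcfType) (z : R[i]) : `|z| = (normc z)%:C.
Proof. by case: z. Qed.

Lemma conjc_conj (R : rcfType) (z : R[i]) : Num.conj z = conjc z.
Proof. by []. Qed.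

Section Characters.
Variables (R : realType) (Gamma : zmodType).
Local Notation G := (dual R Gamma).

Lemma pairingD (a b : Gamma) (x : G) : pairing (a + b) x = pairing a x * pairing b x.
Proof. by have /set_mem[+ _] := valP x; apply. Qed.

Lemma pairing_normc (a : Gamma) (x : G) : normc (pairing a x) = 1.
Proof. by have /set_mem[_ +] := valP x; apply. Qed.

Lemma pairing_conj (a : Gamma) (x : G) : pairing a x * (pairing a x)^* = 1.
Proof. by rewrite -normCK normc_norm pairing_normc expr1n. Qed.

Lemma pairing0 (x : G) : pairing 0 x = 1.
Proof.
have p0 : pairing 0 x != 0.
  by apply/eqP => h; have := pairing_conj 0 x; rewrite h mul0r => /eqP; rewrite eq_sym oner_eq0.
by apply: (mulfI p0); rewrite -pairingD addr0 mulr1.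
Qed.

Lemma pairingN (a : Gamma) (x : G) : pairing (- a) x = (pairing a x)^*.
Proof. by rewrite -[LHS]mul1r -(pairing_conj a x) mulrAC -pairingD subrr pairing0 mul1r. Qed.

Lemma pairing_sum (I : finType) (F : I -> Gamma) (x : G) :
  pairing (\sum_i F i) x = \prod_i pairing (F i) x.
Proof. exact: (big_morph (fun a => pairing a x) (fun a b => pairingD a b x) (pairing0 x)). Qed.

Lemma pairing_continuous (a : Gamma) : continuous (fun x : G => pairing a x : R[i]^o).
Proof.
move=> x; apply: (@continuous_comp _ _ _ (@set_val _ (characters R Gamma))
  (fun f : {ptws Gamma -> R[i]^o} => f a)).
  exact: initial_continuous.
exact: (@proj_continuous _ (fun=> R[i]^o) a).
Qed.

Lemma continuous_dual_measurable (u : G -> R) : continuous u -> measurable_fun setT u.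
Proof.
move=> cu; apply: (measurability _ (RGenOInfty.measurableE R)) => _ [_ [a ->] <-].
rewrite setTI; apply: sub_sigma_algebra.
by apply: open_comp; [move=> x _; exact: cu|exact: interval_open].
Qed.

Lemma part_pairing_continuous (p : R[i] -> R) (a : Gamma) : {morph p : x y / x - y} ->
  (forall z, `|p z| <= normc z) -> continuous (fun x : G => p (pairing a x)).
Proof.
move=> pB p_le x.
have cp (z : R[i]^o) : {for z, continuous (p : R[i]^o -> R)}.
  apply/(@cvgrPdist_lt _ _ _ (nbhs z) (nbhs_filter z)) => e e0.
  have e0' : 0 < e%:C by rewrite ltcR.
  have : nbhs z (ball z e%:C) by exact: nbhsx_ballx.
  apply: filterS => y; rewrite -ball_normE /= -pB -(ltcR `|_|) => h.
  by apply: le_lt_trans h; rewrite lecR; exact: p_le.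
apply: (@continuous_comp _ R[i]^o _ (fun x : G => pairing a x) (p : R[i]^o -> R)) => //.
exact: pairing_continuous.
Qed.

Lemma bounded_measurableC_conj_pairing (a : Gamma) :
  bounded_measurableC (fun x : G => (pairing a x)^*).
Proof.
suff [] : bounded_measurable (fun x : G => complex.Re (pairing a x)) /\
    bounded_measurable (fun x : G => complex.Im (pairing a x)).
  move=> br bi; split.
    rewrite (_ : _ \o _ = fun x => complex.Re (pairing a x))//.
    by apply/funext => x; rewrite /= conjc_conj; case: (pairing a x).
  rewrite (_ : _ \o _ = fun x => -1 * complex.Im (pairing a x)).
    by apply: bounded_measurableM => //; exact: bounded_measurable_cst.
  by apply/funext => x; rewrite /= conjc_conj mulN1r; case: (pairing a x).
split; split.
- apply: continuous_dual_measurable.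
  by apply: part_pairing_continuous; [case=> ? ? []|exact: normr_Re_le].
- by exists 1 => x; rewrite -(pairing_normc a x) normr_Re_le.
- apply: continuous_dual_measurable.
  by apply: part_pairing_continuous; [case=> ? ? []|exact: normr_Im_le].
- by exists 1 => x; rewrite -(pairing_normc a x) normr_Im_le.
Qed.
End Characters.

(** * Riesz products *)

Section RieszProduct.
Variables (R : realType) (Gamma : zmodType).
Local Notation G := (dual R Gamma).
Variables (mu : complex_measure (dual R Gamma) R) (m : nat).
Local Notation n := m.+1.
Variable g : 'I_n -> Gamma.

Definition frequency (e : {ffun 'I_n -> 'I_3}) : Gamma := \sum_l g l *~ digit (e l).

(** The coefficients of [1 + Re z = z^-1 / 2 + 1 + z / 2] for [|z| = 1]. *)
Definition digit_weight (d : 'I_3) : R[i] := if (d : nat) == 1%N then 1 else 2^-1.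

Definition riesz_term N (w : R[i]) (e : {ffun 'I_n -> 'I_3}) (y : {ffun 'I_n -> 'I_N}) : R[i] :=
  (\prod_l digit_weight (e l)) * mono w (fun l => digit (e l)) y.

(** The expanded form can be integrated termwise; distributivity recovers the product, whose sign is
    known. *)
Definition riesz_product N (w : R[i]) (y : {ffun 'I_n -> 'I_N}) (x : G) : R[i] :=
  \sum_e riesz_term w e y * (pairing (frequency e) x)^*.

Definition riesz_coef (e : {ffun 'I_n -> 'I_3}) : R[i] :=
  (\prod_l digit_weight (e l)) * fourier_transform mu (frequency e).

(** The sum is [1 + Re z], where [z] has modulus 1. *)
Lemma riesz_factor N (w : R[i]) (j : nat) (a : Gamma) (x : G) : N.-primitive_root w ->
  0 <= \sum_(d < 3) digit_weight d * w ^ (j%:Z * digit d) * (pairing (a *~ digit d) x)^*.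
Proof.
move=> wp; rewrite !big_ord_recl big_ord0 addr0 /digit_weight.
have -> : digit ord0 = -1 by [].
have -> : digit (lift ord0 ord0) = 0 by [].
have -> : digit (lift ord0 (lift ord0 ord0)) = 1 by [].
rewrite /= mulr0 mulr0z expr0z pairing0 mulrN1 mulrN1z pairingN conjCK conjC1 mulr1 mulr1z.
set z := w ^ j * (pairing a x)^*.
have zn : normc z = 1.
  have : `|z| = 1.
    rewrite normrM normrX (primitive_root_norm wp) expr1n mul1r norm_conjC.
    by rewrite normc_norm pairing_normc.
  by rewrite normc_norm => /complexI.
have -> : w ^ (- j%:Z) = (w ^ j)^* by rewrite (conj_exprz wp).
rewrite !mulr1 -!mulrA -/z.
have -> : (w ^ j)^* * pairing a x = z^* by rewrite rmorphM /= conjCK.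
have -> : 2^-1 * z^* + (1 + 2^-1 * z) = (1 + complex.Re z)%:C.
  by rewrite rmorphD /= ReJ_add -conjc_conj; field.
rewrite ler0c -lerBlDl sub0r; have := normr_Re_le z; rewrite zn.
by rewrite ler_norml => /andP[].
Qed.

Lemma riesz_product_ge0 N (w : R[i]) y x : N.-primitive_root w ->
  0 <= riesz_product (N := N) w y x.
Proof.
move=> wp; rewrite /riesz_product.
have -> : \sum_e riesz_term w e y * (pairing (frequency e) x)^* =
    \prod_l \sum_(d < 3) digit_weight d * w ^ ((y l : nat)%:Z * digit d) *
      (pairing (g l *~ digit d) x)^*.
  rewrite bigA_distr_bigA; apply: eq_bigr => e _.
  rewrite /riesz_term /mono /frequency pairing_sum rmorph_prod.
  by rewrite -!big_split.
by apply: prodr_ge0 => l _; exact: riesz_factor wp.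
Qed.

(** Only the constant monomial survives the summation over the torus, and its coefficient is 1. *)
Lemma sum_riesz_product N (w : R[i]) x : (1 < N)%N -> N.-primitive_root w ->
  \sum_y riesz_product (N := N) w y x = (N ^ n)%:R.
Proof.
move=> N1 wp; rewrite exchange_big (bigD1 [ffun=> inord 1])//= [X in _ + X]big1 => [|e e1].
  rewrite addr0 -mulr_suml -mulr_sumr (sum_mono wp) => [|l]; last first.
    by rewrite (leq_ltn_trans _ N1)// digit_bound.
  have d0 : digit (inord 1) = 0 by rewrite /digit inordK.
  rewrite ifT; last by apply/forallP => l; rewrite ffunE d0.
  rewrite big1 => [|l _]; last by rewrite ffunE /digit_weight inordK.
  rewrite /frequency big1 ?pairing0 ?conjC1 ?mulr1 ?mul1r// => l _.
  by rewrite ffunE d0 mulr0z.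
rewrite -mulr_suml -mulr_sumr (sum_mono wp) => [|l]; last first.
  by rewrite (leq_ltn_trans _ N1)// digit_bound.
rewrite ifF ?mulr0 ?mul0r//; apply/negbTE; apply: contra e1 => /forallP h.
apply/eqP/ffunP => l; apply: digit_inj; rewrite (eqP (h l)) ffunE.
by rewrite /digit inordK.
Qed.

Lemma riesz_product_integral N (w : R[i]) y :
  cmeasure_integral mu (riesz_product (N := N) w y) = digit_poly riesz_coef w y.
Proof.
rewrite cmeasure_integral_sum => [|e]; last exact: bounded_measurableC_conj_pairing.
by apply: eq_bigr => e _; rewrite /riesz_term mulrAC.
Qed.

Variable r : R.
Hypothesis mu_norm : cmeasure_norm mu = r%:E.

(** Duality: the phases [th] turn the sum into one integral against [mu], of a function [u] bounded
    by the sum over [y] of the nonnegative Riesz products, that is, by [N ^ n]. *)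
Lemma sum_digit_poly_le N (w : R[i]) : (1 < N)%N -> N.-primitive_root w ->
  \sum_y `|digit_poly riesz_coef (N := N) w y| <= (N ^ n)%:R * r%:C.
Proof.
move=> N1 wp; pose f y := digit_poly riesz_coef (N := N) w y.
(* A phase with [th y * f y = |f y|], equal to 0 where [f] vanishes. *)
pose th y := Num.conj (f y) / `|f y|.
have bK y : bounded_measurableC (riesz_product (N := N) w y).
  apply: bounded_measurableC_sum => e.
  apply: bounded_measurableCM; first exact: bounded_measurableC_cst.
  exact: bounded_measurableC_conj_pairing.
pose u x := \sum_y th y * riesz_product (N := N) w y x.
have bu : bounded_measurableC u.
  apply: bounded_measurableC_sum => y.
  by apply: bounded_measurableCM => //; exact: bounded_measurableC_cst.
have uN x : normc (u x) <= (N ^ n)%:R.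
  rewrite -lecR -normc_norm rmorph_nat -(sum_riesz_product x N1 wp).
  rewrite (le_trans (ler_norm_sum _ _ _))// ler_sum// => y _.
  rewrite normrM (ger0_norm (riesz_product_ge0 y x wp)) ler_piMl ?riesz_product_ge0//.
  rewrite /th normrM normfV norm_conjC normr_id.
  by have [->|f0] := eqVneq `|f y| 0; rewrite ?mul0r// divff.
have := cmeasure_integral_le_norm bu uN mu_norm.
rewrite cmeasure_integral_sum// -lecR -normc_norm rmorphM /= rmorph_nat.
apply: le_trans; rewrite [X in _ <= `|X|](eq_bigr (fun y => `|f y|)) => [|y _]; last first.
  rewrite -[cmeasure_integral _ _]/(cmeasure_integral mu (riesz_product w y)).
  rewrite riesz_product_integral -/(f y) /th mulrAC mulrC.
  have [f0|f0] := eqVneq `|f y| 0; first by rewrite f0 invr0 mul0r.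
  by rewrite mulrC -normCKC expr2 mulfK.
by rewrite ger0_norm// sumr_ge0.
Qed.

Hypothesis vanish : forall (e : {ffun 'I_n -> 'I_3}) s, walk n s -> exceeds1 n s ->
  (forall l, digit (e l) = walk_incr s l) -> fourier_transform mu (frequency e) = 0.

Lemma riesz_coef_unit l : riesz_coef (unit_digits l) = 2^-1 * fourier_transform mu (g l).
Proof.
congr (_ * fourier_transform mu _).
  rewrite (bigD1 l)//= big1 => [|i il]; rewrite ffunE /digit_weight ?eqxx ?(negPf il) inordK//.
  by rewrite mulr1.
rewrite /frequency (bigD1 l)//= big1 => [|i il]; rewrite ffunE ?eqxx ?(negPf il) /digit inordK//.
by rewrite addr0.
Qed.

(** The weights 1/2 at the frequencies [g l] put the factor 1/4 in front of [S]. The bound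
    [k * (S / 4) <= (4 * k + 5) * r ^+ 2] for all [k > 0] yields [S / 4 <= 4 * r ^+ 2] as [k]
    grows. *)
Lemma sum_fourier_transform_le :
  \sum_l normc (fourier_transform mu (g l)) ^+ 2 <= 16 * r ^+ 2.
Proof.
have c_eq0 (e : {ffun 'I_n -> 'I_3}) s : walk n s -> exceeds1 n s ->
    (forall l, digit (e l) = walk_incr s l) -> riesz_coef e = 0.
  by move=> ws es eE; rewrite /riesz_coef (vanish ws es eE) mulr0.
have nC (q : nat) : (q%:R : R[i]) = (q%:R : R)%:C by rewrite rmorph_nat.
set S := \sum_l _.
have Sle k : (0 < k)%N -> k%:R * (4^-1 * S) <= (4 * k + 5)%:R * r ^+ 2.
  move=> k0; have := digit_poly_paley k0 sum_digit_poly_le c_eq0.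
  rewrite (eq_bigr (fun l => (4^-1 * normc (fourier_transform mu (g l)) ^+ 2)%:C)).
    by rewrite -rmorph_sum /= -mulr_sumr !nC -rmorphXn -!rmorphM lecR.
  move=> l _; rewrite riesz_coef_unit normrM exprMn normfV normr_nat normc_norm.
  by rewrite exprVn -natrX nC -fmorphV -rmorphXn -rmorphM.
rewrite leNgt; apply/negP => h.
pose D := 4^-1 * S - 4 * r ^+ 2; have D0 : 0 < D by rewrite /D; lra.
have := Sle _ (ltn0Sn (Num.truncn (5 * r ^+ 2 / D))).
have := truncnS_gt (5 * r ^+ 2 / D); rewrite ltr_pdivrMr//.
set k := (Num.truncn _).+1 => h1.
rewrite natrD natrM mulrDl => h2.
have : k%:R * D <= 5 * r ^+ 2 by rewrite /D mulrBr; lra.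
by rewrite leNgt h1.
Qed.
End RieszProduct.

(** * From walks to admissible coefficients *)

Section Enumeration.

Lemma fsbig_nth (W : nmodType) (P : set int) (s : seq int) (F : int -> W) :
  uniq s -> (forall j, j \in s -> P j) -> (forall j, P j -> j \notin s -> F j = 0) ->
  \sum_(j \in P) F j = \sum_(i < size s) F (nth 0 s i).
Proof.
move=> us sP Fs.
rewrite -(big_mkord xpredT (fun i => F (nth 0 s i))) -(big_nth 0 xpredT F).
rewrite (fsbig_seq _ _ us); apply/esym/fsbig_widen => [j /= js|j [/= Pj js]].
  exact: sP.
by apply: Fs => //; apply/negP.
Qed.

Variables (J : interval int) (s : seq int) (e : int -> int) (sigma : nat -> nat).
Hypotheses (s_sorted : sorted <%O s) (sJ : forall j, j \in s -> j \in J).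
Hypothesis e_nth : forall i, (i < size s)%N ->
  e (nth 0 s i) = (sigma i.+1)%:Z - (sigma i)%:Z.
Hypothesis e_out : forall j, j \notin s -> e j = 0.
Hypotheses (walk_sigma : walk (size s) sigma).

(** As [s] is increasing, [p j] counts the elements of [s] that are at most [j]. *)
Let p (j : int) := find (fun k => (j < k)%O) s.

Let p_le j : (p j <= size s)%N. Proof. exact: find_size. Qed.

Let nth_lt i k : (i < k)%N -> (k < size s)%N -> (nth 0 s i < nth 0 s k)%O.
Proof.
move=> ik ks; apply: (sorted_ltn_nth lt_trans) => //; rewrite inE//.
exact: ltn_trans ks.
Qed.

Let nth_le j i : (i < size s)%N -> (nth 0 s i <= j)%O = (i < p j)%N.
Proof.
move=> si; rewrite leNgt; apply/negP/idP => [h|/(before_find 0)->//].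
rewrite ltnNge; apply/negP => pi; apply: h.
have hs : has (fun k => (j < k)%O) s by rewrite has_find (leq_ltn_trans pi si).
have hp : (j < nth 0 s (p j))%O := nth_find 0 hs.
apply: lt_le_trans hp _.
by move: pi; rewrite leq_eqVlt => /orP[/eqP ->//|pi]; rewrite ltW// nth_lt.
Qed.

Lemma partial_sum_walk j : partial_sum J e j = (sigma (p j))%:Z.
Proof.
rewrite /partial_sum (@fsbig_nth _ _ [seq k <- s | (k <= j)%O]).
- rewrite -(big_mkord xpredT (fun i => e (nth 0 _ i))) -(big_nth 0 xpredT e).
  rewrite big_filter (big_nth 0) big_mkord.
  rewrite (eq_bigl (fun i : 'I_(size s) => (i < p j)%N)) => [|i]; last exact: nth_le.
  rewrite -(big_ord_widen_cond (size s) xpredT (fun i => e (nth 0 s i)) (p_le j))/=.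
  rewrite (eq_bigr (fun i : 'I_(p j) => (sigma i.+1)%:Z - (sigma i)%:Z)) => [|i _].
    rewrite -(big_mkord xpredT (fun i => (sigma i.+1)%:Z - (sigma i)%:Z)).
    by rewrite telescope_sumr//; have [-> _ _] := walk_sigma; rewrite subr0.
  by rewrite e_nth// (leq_trans (ltn_ord i)).
- by rewrite filter_uniq// (sorted_uniq lt_trans ltxx).
- by move=> k; rewrite mem_filter => /andP[kj /sJ].
- move=> k [kJ kj]; rewrite mem_filter negb_and => /orP[|/e_out//].
  by rewrite kj.
Qed.

(** Along [J] the partial sums follow [sigma], staying constant between elements of [s], so that
    each condition on walks becomes the one on partial sums. *)
Lemma admissible_walk : (forall j, e j \in [:: -1; 0; 1]) -> exceeds1 (size s) sigma ->
  admissible J e.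
Proof.
move=> e3 [i0 i0s i01]; have [s0 sn sp] := walk_sigma.
split => [j _|//|].
- exact: e3.
- apply: (@sub_finite_set _ _ [set` s]); last exact: finite_seq.
  by move=> j /= [_]; apply: contraNT => /e_out ->.
split=> [|j jJ|i j iJ jJ ij|].
- rewrite (@fsbig_nth _ _ s)//; first last.
  + by move=> j _ /e_out.
  + by rewrite (sorted_uniq lt_trans ltxx).
  rewrite (eq_bigr (fun i : 'I_(size s) => (sigma i.+1)%:Z - (sigma i)%:Z)) => [|i _].
    rewrite -(big_mkord xpredT (fun i => (sigma i.+1)%:Z - (sigma i)%:Z)).
    by rewrite telescope_sumr// s0 sn subr0.
  exact: e_nth.
- by rewrite partial_sum_walk.
- rewrite !partial_sum_walk !ltz_nat; apply: sp; rewrite p_le andbT.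
  case: (leqP (p i) (p j)) => // pji.
  have pjs : (p j < size s)%N by exact: leq_trans pji (p_le i).
  have := nth_le i pjs; rewrite pji => /le_trans/(_ ij).
  by rewrite nth_le// ltnn.
(* The walk starts at 0, so it exceeds 1 at some [i.+1]; this value is reached at the index
   [nth 0 s i]. *)
case: i0 i0s i01 => [|i] i0s i01; first by rewrite s0 in i01.
exists (nth 0 s i); first by apply: sJ; rewrite mem_nth.
rewrite partial_sum_walk ltz_nat.
suff -> : p (nth 0 s i) = i.+1 by [].
apply/eqP; rewrite eqn_leq -(nth_le _ i0s) lexx andbT leqNgt; apply/negP => pi.
have si : (i.+1 < size s)%N by exact: leq_trans pi (p_le _).
have := nth_le (nth 0 s i) si; rewrite pi.
by rewrite leNgt nth_lt.
Qed.

End Enumeration.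

(** * Finite lists of indices and passage to the supremum *)

(** Any increasing list of indices in [J] will do: the increments along it of a walk that exceeds 1,
    extended by 0 to the other indices, are admissible on [J], so that their frequency lies in
    [S_set J g]. *)
Lemma sum_fourier_transform_seq_le (R : realType) (Gamma : zmodType)
    (mu : complex_measure (dual R Gamma) R) (J : interval int) (g : int -> Gamma)
    (s : seq int) (r : R) :
  (forall c, S_set J g c -> fourier_transform mu c = 0) ->
  sorted <%O s -> (forall j, j \in s -> j \in J) -> cmeasure_norm mu = r%:E ->
  \sum_(j <- s) normc (fourier_transform mu (g j)) ^+ 2 <= 16 * r ^+ 2.
Proof.
move=> van ss sJ mur.
have us : uniq s by rewrite (sorted_uniq lt_trans ltxx).
case sE : (size s) => [|m].
  by rewrite (size0nil sE) big_nil mulr_ge0// sqr_ge0.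
rewrite (big_nth 0) big_mkord sE.
apply: (@sum_fourier_transform_le _ _ mu m (fun l => g (nth 0 s l)) r mur).
move=> e sigma ws es eE; apply: van.
pose eps j := if j \in s then (sigma (index j s).+1)%:Z - (sigma (index j s))%:Z else 0.
have eps_nth i : (i < size s)%N -> eps (nth 0 s i) = (sigma i.+1)%:Z - (sigma i)%:Z.
  by move=> si; rewrite /eps mem_nth// index_uniq.
have eps_out j : j \notin s -> eps j = 0 by rewrite /eps => /negbTE ->.
exists eps.
  apply: (admissible_walk ss sJ eps_nth eps_out); rewrite ?sE// => j.
  rewrite /eps; case: ifPn => // js; have jm : (index j s < m.+1)%N by rewrite -sE index_mem.
  by have := eE (Ordinal jm); rewrite /walk_incr /= => <-; case: (e _) => -[|[|[|//]]] ?.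
rewrite (fsbig_nth us) => [|j /sJ//|j _ /eps_out ->//]; rewrite sE.
by apply: eq_bigr => l _; rewrite eps_nth ?sE// eE.
Qed.

Theorem theorem5p2 (R : realType) (Gamma : zmodType) (K : set Gamma)
    (mu : complex_measure (dual R Gamma) R) (mu_regular : regular_measure mu)
    (vanish : exists (J : interval int) (g : int -> Gamma),
      enumeration K J g /\
      forall c, S_set J g c -> fourier_transform mu c = 0) :
  ((\esum_(c in K) (normc (fourier_transform mu c) ^+ 2)%:E) `^ 2^-1
   <= 4%:E * cmeasure_norm mu)%E.
Proof.
have [J [g [[gK gI gS] van]]] := vanish.
have mu0 : (0 <= cmeasure_norm mu)%E.
  apply: le_trans (@cmeasure_norm_ge _ _ _ mu unit (fun=> tt) _) => [|[]]; last first.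
    by rewrite (_ : [set _ | _] = setT)//; apply/seteqP; split.
  by rewrite lee_fin sumr_ge0// => i _; case: (mu _) => a b; exact: sqrtr_ge0.
case mur : (cmeasure_norm mu) mu0 => [r| |]//; last first.
  by move=> _; rewrite gt0_muley ?lte_fin// leey.
rewrite lee_fin => r0.
suff le16 : (\esum_(c in K) (normc (fourier_transform mu c) ^+ 2)%:E <= (16 * r ^+ 2)%:E)%E.
  have es0 : (0 <= \esum_(c in K) (normc (fourier_transform mu c) ^+ 2)%:E)%E.
    by apply: esum_ge0 => c _; rewrite lee_fin sqr_ge0.
  have h : (0 <= (2^-1 : R)) by rewrite invr_ge0.
  apply: (le_trans (gt0_ler_poweR h _ _ le16)); rewrite ?in_itv/= ?es0 ?leey ?lee_fin//.
    by rewrite mulr_ge0// sqr_ge0.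
  rewrite powR12_sqrt ?mulr_ge0 ?sqr_ge0//.
  have -> : 16 * r ^+ 2 = (4 * r) ^+ 2 by ring.
  by rewrite sqrtr_sqr ger0_norm ?mulr_ge0.
(* [\esum] is a supremum over finite subsets [A] of [K]. The indices of such an [A], finitely many
   since [g] is injective on [J], are listed in increasing order. *)
apply: ge_ereal_sup => _ [A [Afin AK] <-].
pose D := [set j | j \in J /\ A (g j)].
have Dinj : set_inj D g.
  by move=> i j; rewrite !inE => -[iJ _] [jJ _]; apply: gI; rewrite inE.
have DA : g @` D = A.
  apply/seteqP; split => [_ [j [_ Aj] <-]//|c Ac].
  by have [j jJ jc] := gS c (AK c Ac); exists j => //; split=> //; rewrite jc.
have Dfin : finite_set D by rewrite -(eq_finite_set (inj_card_eq Dinj)) DA.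
have /finite_seqP[X DX] := Dfin.
pose s := sort <=%O (undup X).
have ss : sorted <%O s by rewrite sort_lt_sorted undup_uniq.
have Ds : D = [set` s].
  by rewrite DX; apply/seteqP; split => j /=; rewrite mem_sort mem_undup.
rewrite -DA fsbig_image// Ds -(fsbig_seq _ _ (lt_sorted_uniq ss)) sumEFin lee_fin.
apply: sum_fourier_transform_seq_le van ss _ mur => j js.
by have [] : D j by rewrite Ds.
Qed.
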